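(* Let $g:\mathbb{R}\to\mathbb{C}$ be continuous with $|g(x)|\le A\exp(B|x|^{\rho})$ for all $x\in\mathbb{R}$, for some constants $A,B$ and some $\rho<2$, and let $H$ be the classical solution of the heat equation with boundary condition $g$. Then for every $t>0$ and $x\in\mathbb{R}$, the algorithm output $u_{m,n,n'}(t,x)$ converges to $H(t,x)$ along triples of positive integers $(m,n,n')$ with $n<(n')^{1/2}$ and $n'<(\log m)^{1/2}$, as $m,n,n'\to\infty$. That is, for every $\epsilon>0$ there is $N\in\mathbb{N}$ such that $|u_{m,n,n'}(t,x)-H(t,x)|<\epsilon$ for all positive integers $m,n,n'\ge N$ with $n<(n')^{1/2}$ and $n'<(\log m)^{1/2}$.
   Context: Classical solution: $H(0,x)=g(x)$ and $H(t,x)=\frac{1}{\sqrt{4\pi t}}\int_{\mathbb{R}}\exp\big(\frac{-(x-y)^2}{4t}\big)g(y)\,dy$ for $t>0$. The algorithm: truncate the discretised boundary data, take the discrete Fourier transform in space, solve the resulting discrete-time ODE, truncate in frequency, and take the inverse discrete transform. Explicitly, for positive integers $m,n,n'$ with $n'<m$, with $[\cdot]$ the integer part and $\chi_{[-n,n)}$ the indicator function of $[-n,n)$: $$\hat g_{m,n}\big(\tfrac lm\big)=\frac1m\sum_{k=-m^2}^{m^2-1}g\big(\tfrac km\big)\chi_{[-n,n)}\big(\tfrac km\big)e^{-\pi i\frac{k}{m}\frac{l}{m}},\qquad \psi_m\big(\tfrac lm\big)=m\big(e^{\pi i l/m^2}-1\big)\qquad(-m^2\le l\le m^2-1),$$ $$u_{m,n,n'}(t,x)=\frac1m\sum_{l=-n'm}^{n'm}\tfrac12\,\hat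 g_{m,n}\big(\tfrac lm\big)\Big(1+\tfrac1m\psi_m\big(\tfrac lm\big)^2\Big)^{[mt]}e^{\pi i\frac{l}{m}\frac{[mx]}{m}}.$$ *)

(* Defs.v *)
From HB Require Import structures.
From mathcomp Require Import all_boot all_order all_algebra.
From mathcomp Require Import all_classical all_reals all_analysis.
From mathcomp Require Import complex.

Set Implicit Arguments.
Unset Strict Implicit.
Unset Printing Implicit Defensive.

Import Order.TTheory GRing.Theory Num.Theory.
Import numFieldNormedType.Exports.

Local Open Scope classical_set_scope.
Local Open Scope ring_scope.
Local Open Scope complex_scope.

(* The Lebesgue integral over R of a complex-valued function, by real and
   imaginary parts. *)
Definition cintegral (R : realType) (f : R -> R[i]) : R[i] :=
  (\int[lebesgue_measure]_(y in setT) complex.Re (f y))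
  +i* (\int[lebesgue_measure]_(y in setT) complex.Im (f y)).

(* Only times t >= 0 are meaningful. *)
Definition heat_solution (R : realType) (g : R -> R[i]) (t x : R) : R[i] :=
  if t == 0 then g x
  else (Num.sqrt (4 * pi * t))^-1%:C *
       cintegral (fun y => (expR (- (x - y) ^+ 2 / (4 * t)))%:C * g y).

(* exp (i * theta) *)
Definition expi (R : realType) (theta : R) : R[i] := cos theta +i* sin theta.

(* The sum of F k over the integers k with a <= k < b (0 if b <= a). *)
Definition sumz (R : realType) (a b : int) (F : int -> R[i]) : R[i] :=
  \sum_(j < absz (Num.max 0 (b - a))) F (a + (j : nat)%:Z).

(* Functions on the grid { l / m } are indexed by the integer l: [ghat g m n l]
   and [psi m l] are the values at the point l / m. *)
Definition ghat (R : realType) (g : R -> R[i]) (m n : nat) (l : int) : R[i] :=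
  m%:R^-1 *
  sumz (- (m ^ 2)%N%:Z) (m ^ 2)%N%:Z (fun k =>
    g (k%:~R / m%:R)
    * (\1_(`[- n%:R, n%:R[%classic) (k%:~R / m%:R : R))%:C
    * expi (- (pi * (k%:~R / m%:R) * (l%:~R / m%:R)))).

Definition psi (R : realType) (m : nat) (l : int) : R[i] :=
  m%:R * (expi (pi * l%:~R / m%:R ^+ 2) - 1).

(* The integer part is the floor; in the exponent it is nonnegative as soon as
   t >= 0, so that the integer power is then an ordinary power. *)
Definition heat_approx (R : realType) (g : R -> R[i]) (m n n' : nat)
    (t x : R) : R[i] :=
  m%:R^-1 *
  sumz (- (n' * m)%N%:Z) ((n' * m)%N%:Z + 1) (fun l =>
    2^-1 * ghat g m n l
    * (1 + m%:R^-1 * psi R m l ^+ 2) ^ Num.floor (m%:R * t)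
    * expi (pi * (l%:~R / m%:R) * ((Num.floor (m%:R * x))%:~R / m%:R))).

(* Main.v *)
(* Exchanging the two sums writes the output as (1/m) sum_k g(k/m) K(k/m), where K is
   a finite sum over frequencies.  Since n'^2 < log m and n^2 < n', the difference between
   K(y) and a multiple s of e^{-(x - y)^2 / (4t)} is at most
   poly(n') (e^{-n'^2} + e^{-pi^2 t n'^2}), uniformly for |y| <= n', and this times
   sup_{|y| <= n} |g| <= C e^{delta n^2} <= C e^{delta n'} still tends to 0; moreover s
   tends to the constant 1 / sqrt(4 pi t) of the heat kernel.  Note that g has no modulus of
   continuity on [-n, n] at scale 1/m; only after the Gaussian factor has appeared is
   (1/m) sum_k g(k/m) e^{-(x - k/m)^2 / (4t)} compared with the integral, by dominated
   convergence.

   The Fourier transform of the Gaussian is also computed on finite sums: with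
   S(z) = (1/m) sum_p e^{-a p^2} cos(z p), the quantity S' + z S / (2a) is a Riemann sum of a
   derivative, hence tiny, so S(z) is close to e^{-z^2/(4a)} S(0), and S(0) tends to the
   Gaussian integral sqrt(pi/a). *)

Require Import Defs.
From HB Require Import structures.
From mathcomp Require Import all_boot all_order all_algebra.
From mathcomp Require Import all_classical all_reals all_analysis.
From mathcomp Require Import measurable_realfun complex ring lra.

Import Order.TTheory GRing.Theory Num.Theory.
Import numFieldNormedType.Exports ComplexField.Normc.

Local Open Scope classical_set_scope.
Local Open Scope ring_scope.
Local Open Scope complex_scope.

Set Implicit Arguments.
Unset Strict Implicit.
Unset Printing Implicit Defensive.

(** * Grids, the Gaussian integral and Riemann sums on the line *)

(** Natural indices let sums range over ordinals. Index [N] is the origin, and with [N = n * m] the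
    indices [j < N + N] run over the grid points of [-n, n). *)
Definition grid (R : realType) (m N j : nat) : R := (j%:R - N%:R) / m%:R.

(** The integrand is sqrt(pi/c) times the normal density with mean 0 and standard deviation
    1/sqrt(2c), whose integral is 1. *)
Lemma gaussian_integral (R : realType) (c : R) : 0 < c ->
  (@lebesgue_measure R).-integrable [set: R]
    (EFin \o (fun y => expR (- (c * y ^+ 2)))) /\
  (\int[lebesgue_measure]_y expR (- (c * y ^+ 2)) : R) = Num.sqrt (pi / c).
Proof.
move=> c0; set s := (Num.sqrt (2 * c))^-1.
have s0 : s != 0 by rewrite invr_neq0// sqrtr_eq0 -ltNge mulr_gt0.
have s2 : s ^+ 2 *+ 2 = c^-1.
  by rewrite /s exprVn sqr_sqrtr ?mulr_ge0 ?ltW// -mulr_natl invfM mulrA divff ?mul1r.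
have pE : (s ^+ 2 * pi *+ 2) = pi / c by rewrite -mulrnAl s2 mulrC.
have sq0 : Num.sqrt (pi / c) != 0 by rewrite sqrtr_eq0 -ltNge divr_gt0// pi_gt0.
have fE : (fun y => expR (- (c * y ^+ 2))) =
    (fun y => Num.sqrt (pi / c) * normal_pdf 0 s y).
  apply/funext => y; rewrite normal_pdfE// /normal_peak /normal_fun pE mulVKf//.
  by rewrite subr0 s2 invrK mulNr mulrC.
have int1 := integrable_normal_pdf 0 s.
split.
  rewrite fE; have -> : (EFin \o (fun y => Num.sqrt (pi / c) * normal_pdf 0 s y)) =
      (fun y => (Num.sqrt (pi / c))%:E * (normal_pdf 0 s y)%:E)%E by apply/funext.
  exact: integrableZl.
rewrite fE RintegralZl//.
by rewrite /Rintegral integral_normal_pdf// mulr1.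
Qed.

(** Its integral is the Riemann sum of [h] with left endpoints, so that theorems on integrals of
    functions apply to Riemann sums. *)
Definition step_approx (R : realType) (h : R -> R) (m N : nat) (y : R) : R :=
  \sum_(j < N + N) h (grid R m N j) * \1_(`[grid R m N j, grid R m N j.+1[) y.

Lemma gridS (R : realType) (m N j : nat) :
  grid R m N j.+1 = grid R m N j + m%:R^-1.
Proof. by rewrite /grid -natr1; ring. Qed.

Lemma grid_le (R : realType) (m N i j : nat) : (i <= j)%N ->
  grid R m N i <= grid R m N j.
Proof. by move=> ij; rewrite ler_wpM2r ?invr_ge0 ?ler0n// lerD2r ler_nat. Qed.

Lemma grid_floor (R : realType) (m N : nat) (y : R) : (0 < m)%N ->
  - (N%:R / m%:R) <= y < N%:R / m%:R ->
  exists j : 'I_(N + N), grid R m N j <= y < grid R m N j.+1.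
Proof.
move=> m0 /andP[y1 y2]; have mR : (0 : R) < m%:R by rewrite ltr0n.
have z0 : 0 <= m%:R * y + N%:R.
  by move: y1; rewrite -mulNr ler_pdivrMr// mulrC => ?; lra.
have /andP[k1 k2] := truncn_itv z0.
set k := Num.truncn _ in k1 k2.
have kN : (k < N + N)%N.
  rewrite -(ltr_nat R) (le_lt_trans k1)// natrD ltrD2r.
  by move: y2; rewrite ltr_pdivlMr// mulrC.
exists (Ordinal kN); rewrite /grid/= ler_pdivrMr// ltr_pdivlMr// mulrC.
by apply/andP; split; lra.
Qed.

(** The cells are disjoint, so at most one term of the sum survives. The index of the cell is
    forgotten: domination and pointwise convergence only need that [u] lies within 1/m of [y]. *)
Lemma step_approxP (R : realType) (h : R -> R) (m N : nat) (y : R) : (0 < m)%N ->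
  (step_approx h m N y = 0 /\ ~~ (- (N%:R / m%:R) <= y < N%:R / m%:R)) \/
  exists2 u, step_approx h m N y = h u & u <= y < u + m%:R^-1.
Proof.
move=> m0.
have indE (j : nat) : \1_(`[grid R m N j, grid R m N j.+1[) y =
    (grid R m N j <= y < grid R m N j.+1)%R%:R :> R.
  by rewrite indicE mem_setE in_itv.
have [[j jy]|nj] := pselect (exists j : 'I_(N + N), grid R m N j <= y < grid R m N j.+1).
  right; exists (grid R m N j); last by rewrite -gridS.
  rewrite /step_approx (bigD1 j)//= indE jy mulr1 big1 ?addr0// => i ij.
  rewrite indE; case: (boolP (_ && _)) => [iy|]; last by rewrite mulr0.
  exfalso; move: ij; rewrite -val_eqE/= neq_ltn => /orP[ij|ij].
  - have := grid_le R m N ij.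
    by move: jy iy => /andP[? ?] /andP[? ?]; lra.
  - have := grid_le R m N ij.
    by move: jy iy => /andP[? ?] /andP[? ?]; lra.
left; split.
  rewrite /step_approx big1// => i _; rewrite indE.
  case: (boolP (_ && _)) => [iy|]; last by rewrite mulr0.
  by exfalso; apply: nj; exists i.
by apply/negP => /(grid_floor m0).
Qed.

Lemma integral_step_approx (R : realType) (h : R -> R) (m N : nat) : (0 < m)%N ->
  (@lebesgue_measure R).-integrable [set: R] (EFin \o step_approx h m N) /\
  (\int[lebesgue_measure]_y (step_approx h m N y)%:E)%E =
    (m%:R^-1 * \sum_(j < N + N) h (grid R m N j))%:E.
Proof.
move=> m0; set mu := lebesgue_measure.
have mR : (0 : R) < m%:R by rewrite ltr0n.
pose I j := `[grid R m N j, grid R m N j.+1[%classic.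
have int1 (j : 'I_(N + N)) : mu.-integrable [set: R]
    (fun y => (h (grid R m N j) * \1_(I j) y)%:E).
  under eq_fun do rewrite EFinM.
  by exact: (integrableZl measurableT _ (integrable_indic_itv _ _ true true)).
have stE : (fun y => (step_approx h m N y)%:E) =
   (fun y => (\sum_(j < N + N) (h (grid R m N j) * \1_(I j) y)%:E)%E).
  by apply/funext => y; rewrite /step_approx sumEFin.
split.
  rewrite [X in integrable _ _ X](_ : _ = fun y => (step_approx h m N y)%:E)//.
  by rewrite stE; apply: integrable_sum => // j _; exact: int1.
rewrite stE integral_sum//.
rewrite mulr_sumr -sumEFin; apply: eq_bigr => j _.
under eq_integral do rewrite EFinM.
rewrite integralZl//; last exact: integrable_indic_itv.
rewrite integral_indic; [|by []|exact: measurable_itv].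
rewrite setIT /I [X in (_ * X)%E]lebesgue_measure_itv/= lte_fin gridS ltrDl invr_gt0 mR.
by rewrite -EFinB -EFinM addrAC subrr add0r mulrC.
Qed.

(** The Gaussian bound dominates all the step functions at once, so the mesh 1/m and the window [-n,
    n) may be refined independently of each other. *)
Lemma riemann_sum_cvg (R : realType) (h : R -> R) (D c : R) :
  continuous h -> 0 < c -> (forall y, `|h y| <= D * expR (- (c * y ^+ 2))) ->
  forall eps : R, 0 < eps -> exists N : nat, forall m n : nat,
    (0 < m)%N -> (N <= m)%N -> (N <= n)%N ->
    `| m%:R^-1 * \sum_(j < n * m + n * m) h (grid R m (n * m) j)
       - \int[lebesgue_measure]_y h y | < eps.
Proof.
(* Dominated convergence is stated for sequences: argue on a sequence of bad pairs (m, n). *)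
move=> hc c0 hD eps e0; apply: contrapT => /forallNP H.
have {}H N : exists p : nat * nat, [/\ (0 < p.1)%N, (N <= p.1)%N, (N <= p.2)%N &
    eps <= `| p.1%:R^-1 * \sum_(j < p.2 * p.1 + p.2 * p.1) h (grid R p.1 (p.2 * p.1) j)
       - \int[lebesgue_measure]_y h y |].
  apply: contrapT => /forallNP HN; apply: (H N) => m n m0 Nm Nn.
  by rewrite ltNge; apply/negP => K; apply: (HN (m, n)); split.
have [s Hs] := choice H.
have D0 : 0 <= D.
  by have := hD 0; rewrite expr0n mulr0 oppr0 expR0 mulr1; apply: le_trans.
pose st N := step_approx h (s N).1 ((s N).2 * (s N).1).
(* The dominating function: for 0 <= y - u < 1 one has y^2 / 2 <= u^2 + 1, so moving from [u] to [y]
   costs half of the rate and a factor e^c. *)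
pose g y := D * expR c * expR (- (c / 2 * y ^+ 2)).
have ratE N : ((s N).2 * (s N).1)%:R / (s N).1%:R = (s N).2%:R :> R.
  by have [s0 _ _ _] := Hs N; rewrite natrM mulfK// pnatr_eq0 -lt0n.
have st_dom N y : `|st N y| <= g y.
  have [s0 _ _ _] := Hs N; rewrite /st.
  have [[-> _]|[u -> /andP[u1 u2]]] := step_approxP h ((s N).2 * (s N).1) y s0.
    by rewrite normr0 /g !mulr_ge0// expR_ge0.
  apply: (le_trans (hD u)); rewrite /g -mulrA ler_wpM2l// -expRD ler_expR.
  have V1 : ((s N).1%:R^-1 : R) <= 1 by rewrite invf_le1 ?ler1n ?ltr0n.
  have : 0 <= c * (u ^+ 2 + 1 - y ^+ 2 / 2).
    apply: mulr_ge0; first exact: ltW.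
    have : 0 <= (1 - (y - u)) * (1 + (y - u)) by apply: mulr_ge0; lra.
    have := sqr_ge0 (u - (y - u)); lra.
  by lra.
have st_cvg y : st ^~ y @ \oo --> h y.
  apply/cvgrPdist_lt => e e1.
  have /cvgrPdist_lt /(_ e e1) /nbhs_ballP[d /= d0 hd] := hc y.
  near=> N; have [s0 Nm Nn _] := Hs N; rewrite /st.
  have [[_]|[u -> /andP[u1 u2]]] := step_approxP h ((s N).2 * (s N).1) y s0.
    (* The value 0 outside the window does not occur once N exceeds |y|. *)
    rewrite ratE => /negP; case.
    have NR : (N%:R : R) <= (s N).2%:R by rewrite ler_nat.
    have : `|y| < N%:R by near: N; exact: nbhs_infty_gtr.
    by rewrite ltr_norml => /andP[? ?]; apply/andP; split; lra.
  apply: hd; rewrite /ball/= ltr_norml.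
  have Vd : ((s N).1%:R^-1 : R) < d.
    rewrite invf_plt ?posrE ?ltr0n//; apply: (@lt_le_trans _ _ N%:R); last by rewrite ler_nat.
    by near: N; exact: nbhs_infty_gtr.
  by apply/andP; split; lra.
have mst N : measurable_fun [set: measurableTypeR R] (EFin \o st N : measurableTypeR R -> \bar R).
  have [s0 _ _ _] := Hs N.
  exact: measurable_int (integral_step_approx h ((s N).2 * (s N).1) s0).1.
have mh : measurable_fun [set: measurableTypeR R] (EFin \o h : measurableTypeR R -> \bar R).
  by apply/measurable_EFinP; exact: continuous_measurable_fun.
have cE : {ae (@lebesgue_measure R), forall y, [set: R] y -> (EFin \o st ^~ y) @ \oo --> (EFin \o h) y}.
  by apply: aeW => y _; apply: cvg_EFin; [exact: nearW|exact: st_cvg].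
have gI : (@lebesgue_measure R).-integrable [set: R] (EFin \o g).
  have c20 : 0 < c / 2 by rewrite divr_gt0.
  exact: (integrableZl measurableT (D * expR c) (gaussian_integral c20).1).
have dE : {ae (@lebesgue_measure R), forall y N, [set: R] y -> (`|(EFin \o st N) y| <= (EFin \o g) y)%E}.
  by apply: aeW => y N _; rewrite /= lee_fin; exact: st_dom.
have [hI _] := dominated_convergence measurableT mst mh cE gI dE.
rewrite -[X in _ --> X](fineK (integrable_fin_num measurableT hI)) => /fine_cvgP[_].
move/cvgrPdist_lt => /(_ eps e0)[N _ /(_ N (leqnn N))].
have [s0 _ _] := Hs N.
rewrite /= (integral_step_approx h ((s N).2 * (s N).1) s0).2/= distrC => K1 K2.
by have := lt_le_trans K2 K1; rewrite ltxx.
Unshelve. all: by end_near. Qed.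

(** * Elementary bounds for sine, cosine and the exponential *)

(** The mean value theorem with the endpoints in either order, as it is used between 0 and a point
    of unknown sign. *)
Lemma derive_lipschitz (R : realType) (f df : R -> R) (a b M : R) :
  (forall x : R, is_derive x 1 f (df x)) ->
  (forall x, Num.min a b <= x <= Num.max a b -> `|df x| <= M) ->
  `|f b - f a| <= M * `|b - a|.
Proof.
move=> fdf dfM.
have fc (c d : R) : {within `[c, d], continuous f}.
  apply: derivable_within_continuous => y _.
  exact: (@ex_derive _ _ _ _ _ _ _ (fdf y)).
have [ab|ba] := leP a b.
  have [c cab ->] := MVT_segment ab (fun x _ => fdf x) (fc a b).
  rewrite normrM ler_wpM2r// dfM//.
  by move: cab; rewrite in_itv/= min_l ?max_r.
have [c cab E] := MVT_segment (ltW ba) (fun x _ => fdf x) (fc b a).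
rewrite distrC E [`|b - a|]distrC normrM ler_wpM2r// dfM//.
by move: cab; rewrite in_itv/= min_r ?max_l// ltW.
Qed.

Section elementary_bounds.
Variable R : realType.
Implicit Types s : R.

Lemma between0_norm s (c : R) : Num.min 0 s <= c <= Num.max 0 s -> `|c| <= `|s|.
Proof.
have [s0|s0] := leP 0 s; move=> /andP[c1 c2].
  by rewrite !ger0_norm.
by rewrite !ler0_norm ?lerN2// ltW.
Qed.

Lemma norm_sin_le s : `|sin s| <= `|s|.
Proof.
have := @derive_lipschitz R sin cos 0 s 1 (fun x => is_derive_sin x)
  (fun x _ => cos_max x).
by rewrite sin0 !subr0 mul1r.
Qed.

Lemma sqr_sin_le s : sin s ^+ 2 <= s ^+ 2.
Proof. by rewrite -(normr_idP (sqr_ge0 _)) -[leRHS](normr_idP (sqr_ge0 _)) !normrX lerXn2r ?nnegrE// norm_sin_le. Qed.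

Lemma onem_cosE s : 1 - cos s = 2 * sin (s / 2) ^+ 2.
Proof.
have -> : cos s = cos ((s / 2) *+ 2) by congr cos; rewrite mulr2n; field.
by rewrite cos_mulr2n sin2cos2; ring.
Qed.

Lemma onem_cos_ge0 s : 0 <= 1 - cos s.
Proof. by rewrite onem_cosE mulr_ge0// sqr_ge0. Qed.

Lemma onem_cos_le s : 1 - cos s <= s ^+ 2 / 2.
Proof. by rewrite onem_cosE; have := sqr_sin_le (s / 2); lra. Qed.

(** Two applications of the mean value inequality, starting from 1 - cos v <= v^2 / 2. The constant
    1/2 is carried along instead of being improved at each integration. *)
Lemma cos_taylor2 s : `|1 - cos s - s ^+ 2 / 2| <= s ^+ 4 / 2.
Proof.
have sin3 u : `|u| <= `|s| -> `|sin u - u| <= `|s| ^+ 3 / 2.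
  move=> us.
  have H1 (v : R) : is_derive v 1 (fun v : R => sin v - v) (cos v - 1).
    by apply: is_derive_eq.
  have H2 (v : R) : Num.min 0 u <= v <= Num.max 0 u -> `|cos v - 1| <= `|s| ^+ 2 / 2.
    move=> /between0_norm vu; rewrite distrC ger0_norm ?onem_cos_ge0//.
    apply: (le_trans (onem_cos_le v)); rewrite ler_wpM2r// -real_normK ?num_real//.
    by rewrite lerXn2r ?nnegrE// (le_trans vu).
  have := derive_lipschitz H1 H2; rewrite sin0 !subr0.
  by have := ler_wpM2l (exprn_ge0 2 (normr_ge0 s)) us; rewrite -(exprSr _ 2); lra.
have H1 (v : R) : is_derive v 1 (fun v : R => 1 - cos v - v ^+ 2 / 2) (sin v - v).
  by apply: is_derive_eq; rewrite /GRing.scale/=; field.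
have H2 (v : R) : Num.min 0 s <= v <= Num.max 0 s -> `|sin v - v| <= `|s| ^+ 3 / 2.
  by move=> /between0_norm; exact: sin3.
have := derive_lipschitz H1 H2; rewrite cos0 expr0n/= mul0r !subrr !subr0.
by rewrite [_ / 2 * _]mulrAC -(exprSr _ 3) -normrX (ger0_norm (_ : 0 <= s ^+ 4))// exprn_even_ge0.
Qed.

Lemma expRN_lipschitz (u v : R) : 0 <= u -> 0 <= v ->
  `|expR (- u) - expR (- v)| <= `|u - v|.
Proof.
move=> u0 v0.
have H1 (w : R) : is_derive w 1 (fun w : R => expR (- w)) (- expR (- w)).
  by apply: is_derive_eq; rewrite /GRing.scale/=; ring.
have H2 (w : R) : Num.min v u <= w <= Num.max v u -> `|- expR (- w)| <= 1.
  move=> /andP[w1 _].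
  have w0 : 0 <= w by apply: le_trans w1; rewrite le_min v0 u0.
  by rewrite normrN ger0_norm ?expR_ge0// -expR0 ler_expR; lra.
by have := derive_lipschitz H1 H2; rewrite mul1r.
Qed.

Lemma expRN_taylor1 s : 0 <= s -> `|1 - s - expR (- s)| <= s ^+ 2.
Proof.
move=> s0.
have H1 (v : R) : is_derive v 1 (fun v : R => 1 - v - expR (- v)) (expR (- v) - 1).
  by apply: is_derive_eq; rewrite /GRing.scale/=; ring.
have H2 (v : R) : Num.min 0 s <= v <= Num.max 0 s -> `|expR (- v) - 1| <= s.
  rewrite min_l// max_r// => /andP[v0 vs].
  have := expRN_lipschitz v0 (lexx 0); rewrite oppr0 expR0 addr0 (ger0_norm v0).
  by move=> /le_trans; apply.
have := derive_lipschitz H1 H2.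
by rewrite oppr0 expR0 !addr0 subrr subr0 (ger0_norm s0) -expr2.
Qed.
End elementary_bounds.

(** * The modulus of complex numbers and the exponential e^{i theta} *)

Section normc_theory.
Variable R : realType.
Implicit Types z w : R[i].

(** The norm of [R[i]] takes its values in [R[i]]; through [normc] the estimates take place in [R],
    where [lra] applies. *)
Lemma normcE z : `|z| = (normc z)%:C.
Proof. by case: z => a b; rewrite normc_def. Qed.

Lemma normc_ge0 z : 0 <= normc z.
Proof. by case: z => a b; exact: sqrtr_ge0. Qed.

Lemma normcD z w : normc (z + w) <= normc z + normc w.
Proof. exact: le_normcD. Qed.

Lemma normcB z w : normc (z - w) <= normc z + normc w.
Proof. by apply: (le_trans (normcD _ _)); rewrite lerD2l normcN. Qed.

Lemma normc_distD w z y : normc (z - y) <= normc (z - w) + normc (w - y).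
Proof. by apply: le_trans (normcD _ _); rewrite addrA subrK. Qed.

Lemma normc_sum (n : nat) (F : 'I_n -> R[i]) :
  normc (\sum_i F i) <= \sum_i normc (F i).
Proof.
elim/big_ind2 : _ => [|x u y v xu yv|i _]; first by rewrite normc0.
  by apply: (le_trans (normcD _ _)); exact: lerD.
by [].
Qed.

Lemma normcX z n : normc (z ^+ n) = normc z ^+ n.
Proof.
by elim: n => [|n IH]; rewrite ?normc1 ?expr0// !exprS normcM IH.
Qed.

Lemma normc_real (r : R) : normc r%:C = `|r|.
Proof. by rewrite /= expr0n addr0 sqrtr_sqr. Qed.

Lemma normc_nat (n : nat) : normc (n%:R : R[i]) = n%:R.
Proof. by rewrite -(rmorph_nat (real_complex R)) normc_real normr_nat. Qed.

Lemma normc_le_ReIm z : normc z <= `|complex.Re z| + `|complex.Im z|.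
Proof.
rewrite [X in normc X](complexE z); apply: (le_trans (normcD _ _)).
rewrite normcM !normc_real lerD2l /= expr0n/= expr1n add0r sqrtr1 mul1r.
by [].
Qed.

Lemma normc_expi (u : R) : normc (expi u) = 1.
Proof. by rewrite /expi /= cos2Dsin2 sqrtr1. Qed.

Lemma expiD (u v : R) : expi (u + v) = expi u * expi v.
Proof. by apply/eqP; rewrite eq_complex/= cosD sinD addrC eqxx [X in _ == X]addrC eqxx. Qed.

(** The square of the left side is 2 (1 - cos(u - v)), which is at most (u - v)^2. *)
Lemma normc_expi_dist (u v : R) : normc (expi u - expi v) <= `|u - v|.
Proof.
rewrite -[leRHS]ger0_norm// -sqrtr_sqr /= ler_sqrt ?sqr_ge0// real_normK ?num_real//.
have := onem_cos_le (u - v); rewrite cosB.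
have := cos2Dsin2 u; have := cos2Dsin2 v; nra.
Qed.
End normc_theory.

(** * Time stepping at one frequency, compared with the heat multiplier *)

Section one_step.
Variable R : realType.

(** Errors accumulate linearly over the steps. Since [q] may have modulus slightly above 1, the
    factor (1 + d)^N appears; it stays bounded when N d does. *)
Lemma normc_subX (q b : R[i]) (d : R) (N : nat) : 0 <= d -> normc b <= 1 ->
  normc (q - b) <= d -> normc (q ^+ N - b ^+ N) <= N%:R * d * (1 + d) ^+ N.
Proof.
move=> d0 b1 qbd.
have q1 : normc q <= 1 + d.
  by rewrite -[q](subrK b) addrC; apply: (le_trans (normcD _ _)); exact: lerD.
elim: N => [|N IH]; first by rewrite !expr0 subrr normc0 !mul0r.
have -> : q ^+ N.+1 - b ^+ N.+1 = q * (q ^+ N - b ^+ N) + (q - b) * b ^+ N.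
  by rewrite !exprS; ring.
apply: (le_trans (normcD _ _)); rewrite !normcM normcX.
have H1 : normc q * normc (q ^+ N - b ^+ N) <= (1 + d) * (N%:R * d * (1 + d) ^+ N).
  by apply: ler_pM => //; exact: normc_ge0.
have H2 : normc (q - b) * normc b ^+ N <= d * (1 + d) ^+ N.+1.
  apply: ler_pM => //; rewrite ?normc_ge0 ?exprn_ge0 ?normc_ge0//.
  apply: (@le_trans _ _ 1); first by rewrite exprn_ile1 ?normc_ge0.
  by rewrite exprn_ege1// lerDl.
apply: (le_trans (lerD H1 H2)); rewrite -natr1 exprS le_eqVlt; apply/orP; left.
by apply/eqP; ring.
Qed.

(* Because (e^{iu} - 1)^2 = - 2 (1 - cos u) e^{iu}. *)
Lemma psi_step (m : nat) (l : int) (u : R) : (0 < m)%N -> u = pi * l%:~R / m%:R ^+ 2 ->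
  1 + m%:R^-1 * psi R m l ^+ 2 = 1 - (2 * m%:R * (1 - cos u))%:C * expi u.
Proof.
move=> m0 ->; rewrite /psi; set v := _ / _.
have mC : (m%:R : R[i]) != 0 by rewrite pnatr_eq0 -lt0n.
have -> : (m%:R^-1 : R[i]) * (m%:R * (expi v - 1)) ^+ 2 = m%:R * (expi v - 1) ^+ 2.
  by field.
have -> : (expi v - 1) ^+ 2 = - (2 * (1 - cos v))%:C * expi v.
  apply/eqP; rewrite eq_complex expr2 /=; have := cos2Dsin2 v.
  by move=> H; apply/andP; split; apply/eqP; [nra|ring].
have -> : 2 * m%:R * (1 - cos v) = m%:R * (2 * (1 - cos v)) by ring.
rewrite [X in _ = _ - X * _]rmorphM /= rmorph_nat; ring.
Qed.

(** With s = M u^2, three replacements are made: 2 (1 - cos u) by u^2, e^{iu} by 1, and 1 - s by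
    e^{-s}. They cost M u^4, s |u| and s^2 respectively. *)
Lemma step_bound (M u : R) : 0 <= M ->
  normc (1 - (2 * M * (1 - cos u))%:C * expi u - (expR (- (M * u ^+ 2)))%:C)
    <= M * (`|u| ^+ 4 + `|u| ^+ 3) + M ^+ 2 * `|u| ^+ 4.
Proof.
move=> M0; set s := M * u ^+ 2.
have s0 : 0 <= s by rewrite mulr_ge0// sqr_ge0.
have M20 : 0 <= 2 * M by rewrite mulr_ge0.
have -> : 1 - (2 * M * (1 - cos u))%:C * expi u - (expR (- s))%:C =
    (1 - s - expR (- s))%:C - s%:C * (expi u - expi 0)
    - (2 * M * (1 - cos u - u ^+ 2 / 2))%:C * expi u.
  have -> : expi 0 = 1 :> R[i] by rewrite /expi cos0 sin0.
  have -> : 2 * M * (1 - cos u) = 2 * M * (1 - cos u - u ^+ 2 / 2) + s by rewrite /s; field.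
  by rewrite !rmorphD !rmorphN /= rmorph1; ring.
have u4 : `|u| ^+ 4 = u ^+ 4 by rewrite -normrX ger0_norm// exprn_even_ge0.
have u2 : `|u| ^+ 2 = u ^+ 2 by rewrite -normrX ger0_norm// exprn_even_ge0.
apply: (le_trans (normcB _ _)); apply: (@le_trans _ _ (s ^+ 2 + s * `|u| + 2 * M * (u ^+ 4 / 2))).
  apply: lerD; [apply: (le_trans (normcB _ _)); apply: lerD|].
  - by rewrite normc_real; exact: expRN_taylor1.
  - rewrite normcM normc_real (ger0_norm s0) ler_wpM2l//.
    by apply: (le_trans (normc_expi_dist _ _)); rewrite subr0.
  - rewrite normcM normc_real normc_expi mulr1 normrM (ger0_norm M20).
    by rewrite ler_wpM2l//; exact: cos_taylor2.
have u3 : M * u ^+ 2 * `|u| = M * `|u| ^+ 3 by rewrite -u2; ring.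
by rewrite u4 /s u3 le_eqVlt; apply/orP; left; apply/eqP; field.
Qed.

(** In use, [M] is m, [n] is the frequency cutoff n', [p] is a frequency, [N] is the number
    floor(mt) of time steps, and [X - x] is the error of rounding the space variable to the grid. *)
Lemma term_bound (t M n p X x : R) (N : nat) :
  0 < t -> 1 <= M -> 1 <= n -> `|p| <= n -> n ^+ 4 <= 2 * M ->
  N%:R <= t * M -> t * M <= N%:R + 1 -> `|X - x| <= M^-1 ->
  normc ((1 - (2 * M * (1 - cos (pi * p / M)))%:C * expi (pi * p / M)) ^+ N
          * expi (pi * p * X)
         - (expR (- (t * pi ^+ 2 * p ^+ 2)))%:C * expi (pi * p * x))
   <= (3 * t * pi ^+ 4 * expR (6 * t * pi ^+ 4) + pi ^+ 2 + pi) * (n ^+ 4 / M).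
Proof.
move=> t0 M1 n1 pn nM Nt tN Xx.
have M0 : 0 < M by lra.
have n0 : 0 <= n by lra.
have Mn0 : M != 0 by rewrite gt_eqF.
have pi0 := pi_ge0 R; have pi2 := pi_ge2 R.
set u := pi * p / M; set q := 1 - _; set e1 := expi (pi * p * X); set e2 := expi _.
set B := expR (- (t * _ * _)); pose b := expR (- (M * u ^+ 2)).
pose Q := pi * n.
have Q1 : 1 <= Q by rewrite /Q; nra.
have Q0 : 0 <= Q by lra.
have uQ : `|u| <= Q / M.
  rewrite /u normrM normfV (gtr0_norm M0) ler_wpM2r ?invr_ge0 ?(ltW M0)//.
  by rewrite normrM (ger0_norm pi0) ler_wpM2l.
have MV0 : 0 <= M^-1 by rewrite invr_ge0 ltW.
have MV1 : M^-1 <= 1 by rewrite invf_le1.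
(* Each of the three terms in [step_bound] is at most Q^4 / M^2, because |u| <= Q / M, Q >= 1 and M
   >= 1. *)
pose d := 3 * Q ^+ 4 / M ^+ 2.
have d0 : 0 <= d by rewrite /d !mulr_ge0// ?exprn_ge0// invr_ge0 exprn_ge0// ltW.
have uk k : `|u| ^+ k <= Q ^+ k / M ^+ k.
  by rewrite -expr_div_n lerXn2r// nnegrE ?divr_ge0// ltW.
have qbd : normc (q - b%:C) <= d.
  apply: (le_trans (step_bound u (ltW M0))).
  have -> : d = Q ^+ 4 / M ^+ 2 + Q ^+ 4 / M ^+ 2 + Q ^+ 4 / M ^+ 2 by rewrite /d; ring.
  rewrite mulrDr; apply: lerD; first apply: lerD.
  - apply: (le_trans (ler_wpM2l (ltW M0) (uk 4%N))).
    have -> : M * (Q ^+ 4 / M ^+ 4) = (Q ^+ 4 / M ^+ 2) * M^-1 by field.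
    by rewrite ler_piMr// mulr_ge0 ?exprn_ge0// invr_ge0 exprn_ge0// ltW.
  - apply: (le_trans (ler_wpM2l (ltW M0) (uk 3%N))).
    have -> : M * (Q ^+ 3 / M ^+ 3) = Q ^+ 3 / M ^+ 2 by field.
    rewrite ler_wpM2r ?invr_ge0 ?exprn_ge0 ?(ltW M0)//.
    by rewrite [leRHS]exprS ler_peMl// exprn_ge0.
  - apply: (le_trans (ler_wpM2l (exprn_ge0 2 (ltW M0)) (uk 4%N))).
    by have -> : M ^+ 2 * (Q ^+ 4 / M ^+ 4) = Q ^+ 4 / M ^+ 2 by field.
have b1 : normc b%:C <= 1.
  rewrite normc_real ger0_norm ?expR_ge0// -expR0 ler_expR oppr_le0.
  by rewrite mulr_ge0 ?sqr_ge0// ltW.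
have Nd : N%:R * d <= 3 * t * pi ^+ 4 * (n ^+ 4 / M).
  apply: (le_trans (ler_wpM2r d0 Nt)); rewrite /d /Q le_eqVlt; apply/orP; left.
  by apply/eqP; field.
(* This keeps N d bounded independently of M, so the N steps amplify the one-step error by a bounded
   factor only. *)
have nM2 : n ^+ 4 / M <= 2 by rewrite ler_pdivrMr.
have nM0 : 0 <= n ^+ 4 / M by rewrite divr_ge0 ?exprn_ge0// ltW.
have pi4 : 0 <= 3 * t * pi ^+ 4 by rewrite !mulr_ge0 ?exprn_ge0// ltW.
have dN : (1 + d) ^+ N <= expR (6 * t * pi ^+ 4).
  apply: (@le_trans _ _ (expR d ^+ N)).
    by rewrite lerXn2r ?nnegrE ?expR_ge0 ?expR_ge1Dx// addr_ge0.
  rewrite -expRM_natl ler_expR; apply: (le_trans Nd).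
  by have := ler_wpM2l pi4 nM2; lra.
have n1k k : (k <= 4)%N -> n ^+ k / M <= n ^+ 4 / M.
  by move=> k4; rewrite ler_wpM2r// ler_weXn2l.
(* Three errors: the scheme against N exact factors e^{-M u^2}, the time N / M against t, and [X]
   against [x]. They give the three summands of the constant. *)
have -> : q ^+ N * e1 - B%:C * e2 =
   (q ^+ N - b%:C ^+ N) * e1 + (b ^+ N - B)%:C * e1 + B%:C * (e1 - e2).
  by rewrite rmorphB rmorphXn /=; ring.
rewrite [leRHS]mulrDl [X in _ <= X + _]mulrDl; apply: (le_trans (normcD _ _)); apply: lerD.
  apply: (le_trans (normcD _ _)); apply: lerD.
  - rewrite normcM normc_expi mulr1; apply: (le_trans (normc_subX N d0 b1 qbd)).
    rewrite [leRHS]mulrAC; apply: ler_pM => //; first by rewrite mulr_ge0.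
    by rewrite exprn_ge0// addr_ge0.
  - rewrite normcM normc_expi mulr1 normc_real /b -expRM_natl mulrN.
    have h1 : 0 <= N%:R * (M * u ^+ 2) by rewrite mulr_ge0 ?ler0n// mulr_ge0 ?sqr_ge0// ltW.
    have h2 : 0 <= t * pi ^+ 2 * p ^+ 2 by rewrite mulr_ge0 ?sqr_ge0// mulr_ge0 ?sqr_ge0// ltW.
    apply: (le_trans (expRN_lipschitz h1 h2)).
    have -> : N%:R * (M * u ^+ 2) - t * pi ^+ 2 * p ^+ 2 =
        pi ^+ 2 * (p ^+ 2 / M) * (N%:R - t * M) by rewrite /u; field.
    rewrite normrM; apply: (@le_trans _ _ (pi ^+ 2 * (n ^+ 2 / M) * 1)).
      apply: ler_pM => //; last by rewrite ler_norml; apply/andP; split; lra.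
      rewrite ger0_norm; last by rewrite mulr_ge0 ?sqr_ge0// divr_ge0 ?sqr_ge0// ltW.
      rewrite ler_wpM2l ?sqr_ge0// ler_wpM2r// -real_normK ?num_real//.
      by rewrite lerXn2r ?nnegrE.
    by rewrite mulr1 ler_wpM2l ?sqr_ge0// n1k.
rewrite normcM normc_real ger0_norm ?expR_ge0//.
apply: (@le_trans _ _ (1 * (pi * (n ^+ 1 / M)))); last by rewrite mul1r ler_wpM2l// n1k.
apply: ler_pM; rewrite ?expR_ge0 ?normc_ge0//.
  by rewrite -expR0 ler_expR oppr_le0 mulr_ge0 ?sqr_ge0// mulr_ge0 ?sqr_ge0// ltW.
apply: (le_trans (normc_expi_dist _ _)); rewrite -mulrBr normrM normrM (ger0_norm pi0).
by rewrite expr1 mulrA; apply: ler_pM => //; rewrite ?mulr_ge0// ler_wpM2l.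
Qed.
End one_step.

(** * Gaussian sums and their Fourier transform *)

Section gaussian_sum.
Variable R : realType.

(** The mean value inequality for f(v) - v f'(p), whose derivative is f'(v) - f'(p). The Taylor
    constant 1/2 is given up. *)
Lemma taylor1_bound (f df ddf : R -> R) (p h B : R) : 0 <= h ->
  (forall v : R, is_derive v 1 f (df v)) ->
  (forall v : R, is_derive v 1 df (ddf v)) ->
  (forall v, p <= v <= p + h -> `|ddf v| <= B) ->
  `|f (p + h) - f p - h * df p| <= B * h ^+ 2.
Proof.
move=> h0 fdf dfd dB.
have B0 : 0 <= B by apply: le_trans (dB p _); rewrite // lexx lerDl.
have H1 (v : R) : is_derive v 1 (fun v => f v - v * df p) (df v - df p).
  by apply: is_derive_eq; rewrite /GRing.scale/=; ring.
have H2 (v : R) : Num.min p (p + h) <= v <= Num.max p (p + h) -> `|df v - df p| <= B * h.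
  rewrite min_l ?max_r ?lerDl// => /andP[pv vh].
  have H3 (w : R) : Num.min p v <= w <= Num.max p v -> `|ddf w| <= B.
    by rewrite min_l// max_r// => /andP[pw wv]; apply: dB; rewrite pw (le_trans wv).
  apply: (le_trans (derive_lipschitz dfd H3)); rewrite ler_wpM2l// ger0_norm; lra.
have := derive_lipschitz H1 H2.
rewrite [p + h - p]addrAC subrr add0r (ger0_norm h0) -mulrA -expr2.
by congr (`|_| <= _); ring.
Qed.

(** The grid is symmetric with both endpoints included, like the frequencies -n'm, ..., n'm of the
    algorithm. *)
Definition gauss_sum (a : R) (m L : nat) (z : R) : R :=
  m%:R^-1 * \sum_(j < (L + L).+1)
    expR (- (a * grid R m L j ^+ 2)) * cos (z * grid R m L j).

Variables (a : R) (a0 : 0 < a).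

(** An antiderivative in [p] of the summand [dphi] of S' + z S / (2a), where S is [gauss_sum];
    [ddphi] controls the Riemann sum error. *)
Let phi (z p : R) := expR (- (a * p ^+ 2)) * sin (z * p) / (2 * a).
Let dphi (z p : R) := expR (- (a * p ^+ 2)) *
  (z / (2 * a) * cos (z * p) - p * sin (z * p)).
Let ddphi (z p : R) := expR (- (a * p ^+ 2)) *
  ((2 * a * p ^+ 2 - 1 - z ^+ 2 / (2 * a)) * sin (z * p) - 2 * p * z * cos (z * p)).

Let phiE (z p : R) : is_derive p 1 (phi z) (dphi z p).
Proof.
by apply: is_derive_eq; rewrite /GRing.scale/= /dphi; field; rewrite gt_eqF.
Qed.

Let dphiE (z p : R) : is_derive p 1 (dphi z) (ddphi z p).
Proof.
by apply: is_derive_eq; rewrite /GRing.scale/= /ddphi; field; rewrite gt_eqF.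
Qed.

Let ddphi_bound (z p P : R) : `|p| <= P ->
  `|ddphi z p| <= 1 + (`|z| + 2 * a * P) ^+ 2 / (2 * a).
Proof.
move=> pP; have P0 : 0 <= P by apply: le_trans pP.
have p2 : p ^+ 2 <= P ^+ 2 by rewrite -real_normK ?num_real// lerXn2r ?nnegrE.
have a20 : 0 < 2 * a by rewrite mulr_gt0.
have z2 : 0 <= z ^+ 2 / (2 * a) by rewrite divr_ge0 ?sqr_ge0// ltW.
rewrite /ddphi normrM ger0_norm ?expR_ge0//; apply: (le_trans (ler_piMl _ _)) => //.
  by rewrite -expR0 ler_expR oppr_le0 mulr_ge0 ?sqr_ge0// ltW.
apply: (@le_trans _ _ ((2 * a * P ^+ 2 + 1 + z ^+ 2 / (2 * a)) * 1 + (2 * P * `|z|) * 1)).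
  apply: (le_trans (ler_normB _ _)); apply: lerD; rewrite normrM; apply: ler_pM => //.
  - have ap : 2 * a * p ^+ 2 <= 2 * a * P ^+ 2 by rewrite ler_wpM2l// ltW.
    have ap0 : 0 <= 2 * a * p ^+ 2 by rewrite mulr_ge0 ?sqr_ge0// ltW.
    by rewrite ler_norml; apply/andP; split; lra.
  - exact: sin_max.
  - by rewrite !normrM (ger0_norm (ler0n _ _)) ler_wpM2r// ler_wpM2l.
  - exact: cos_max.
rewrite !mulr1 -[z ^+ 2]real_normK ?num_real// le_eqVlt; apply/orP; left; apply/eqP.
by field; rewrite gt_eqF.
Qed.

(** The increments of [phi] telescope to two boundary values at distance at least n from 0, each at
    most e^{-a n^2} / (2a). The Taylor errors of the 2nm + 1 <= 3nm cells make up the second term; n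
    + 1 occurs because the last cell ends at n + 1/m. *)
Lemma gauss_ode_bound (m n : nat) (z : R) : (0 < m)%N -> (0 < n)%N ->
  `|m%:R^-1 * \sum_(j < (n * m + n * m).+1) dphi z (grid R m (n * m) j)|
   <= expR (- (a * n%:R ^+ 2)) / a +
      3 * (n%:R / m%:R) * (1 + (`|z| + 2 * a * (n%:R + 1)) ^+ 2 / (2 * a)).
Proof.
move=> m0 n0; set L := (n * m)%N; set B := (1 + _).
have mR : (0 : R) < m%:R by rewrite ltr0n.
have m1 : (1 : R) <= m%:R by rewrite ler1n.
have n1 : (1 : R) <= n%:R by rewrite ler1n.
have mV1 : (m%:R^-1 : R) <= 1 by rewrite invf_le1.
have mV0 : (0 : R) <= m%:R^-1 by rewrite invr_ge0 ltW.
have LE : L%:R / m%:R = n%:R :> R by rewrite /L natrM mulfK// gt_eqF.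
have B0 : 0 <= B.
  rewrite addr_ge0// divr_ge0 ?sqr_ge0// mulr_ge0// ltW//.
have gB (j : 'I_(L + L).+1) : - n%:R <= grid R m L j <= n%:R.
  rewrite /grid mulrBl LE; apply/andP; split.
    by rewrite lerBrDr addrC subrr divr_ge0.
  rewrite lerBlDr -LE -mulrDl ler_wpM2r// -natrD ler_nat.
  by have := ltn_ord j; rewrite ltnS.
have tay (j : 'I_(L + L).+1) :
    `|phi z (grid R m L j.+1) - phi z (grid R m L j) - m%:R^-1 * dphi z (grid R m L j)|
      <= B * m%:R^-1 ^+ 2.
  rewrite gridS; apply: (taylor1_bound mV0 (phiE z) (dphiE z)) => v /andP[v1 v2].
  apply: ddphi_bound; have /andP[g1 g2] := gB j.
  by rewrite ler_norml; apply/andP; split; lra.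
have tel : \sum_(j < (L + L).+1) (phi z (grid R m L j.+1) - phi z (grid R m L j)) =
    phi z (grid R m L (L + L).+1) - phi z (grid R m L 0).
  by rewrite -(big_mkord xpredT (fun j => phi z (grid R m L j.+1) - phi z (grid R m L j))) telescope_sumr.
have phiB p : n%:R <= `|p| -> `|phi z p| <= expR (- (a * n%:R ^+ 2)) / (2 * a).
  move=> np; rewrite /phi normrM normfV (gtr0_norm (_ : 0 < 2 * a)) ?mulr_gt0//.
  rewrite ler_wpM2r ?invr_ge0 ?mulr_ge0 ?(ltW a0)// normrM ger0_norm ?expR_ge0//.
  rewrite -[leRHS]mulr1; apply: ler_pM; rewrite ?expR_ge0 ?sin_max//.
  rewrite ler_expR lerN2 ler_wpM2l ?(ltW a0)// -[leRHS]real_normK ?num_real//.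
  by rewrite lerXn2r ?nnegrE.
have -> : m%:R^-1 * (\sum_(j < (L + L).+1) dphi z (grid R m L j)) =
   phi z (grid R m L (L + L).+1) - phi z (grid R m L 0) -
   \sum_(j < (L + L).+1) (phi z (grid R m L j.+1) - phi z (grid R m L j)
     - m%:R^-1 * dphi z (grid R m L j)).
  by rewrite sumrB tel mulr_sumr; ring.
apply: (le_trans (ler_normB _ _)); apply: lerD.
  have -> : expR (- (a * n%:R ^+ 2)) / a =
    expR (- (a * n%:R ^+ 2)) / (2 * a) + expR (- (a * n%:R ^+ 2)) / (2 * a).
    by field; rewrite gt_eqF.
  apply: (le_trans (ler_normB _ _)); apply: lerD; apply: phiB.
    rewrite /grid -natr1 natrD; have -> : (L%:R + L%:R + 1 - L%:R) / m%:R = n%:R + m%:R^-1 :> R.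
      by rewrite -LE; ring.
    by rewrite ger0_norm; lra.
  by rewrite /grid sub0r mulNr normrN LE ger0_norm.
apply: (le_trans (ler_norm_sum _ _ _)); apply: (le_trans (ler_sum _ (fun j _ => tay j))).
rewrite sumr_const card_ord -[_ *+ _]mulr_natl.
have -> : 3 * (n%:R / m%:R) * B = (3 * L%:R) * (B * m%:R^-1 ^+ 2).
  by rewrite /L natrM; field; rewrite gt_eqF.
rewrite ler_wpM2r ?mulr_ge0 ?sqr_ge0// -natr1 natrD.
have : (1 : R) <= L%:R by rewrite ler1n /L muln_gt0 n0.
by lra.
Qed.

Lemma gauss_sum_is_derive (m L : nat) (z : R) :
  is_derive z 1 (gauss_sum a m L)
   (m%:R^-1 * \sum_(j < (L + L).+1)
    - (grid R m L j * expR (- (a * grid R m L j ^+ 2)) * sin (z * grid R m L j))).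
Proof.
have -> : gauss_sum a m L = m%:R^-1 \*: (\sum_(j < (L + L).+1)
    fun z => expR (- (a * grid R m L j ^+ 2)) * cos (z * grid R m L j)).
  by apply/funext => u; rewrite /gauss_sum/= fct_sumE.
have H (j : 'I_(L + L).+1) : is_derive z 1
    (fun z : R => expR (- (a * grid R m L j ^+ 2)) * cos (z * grid R m L j))
    (- (grid R m L j * expR (- (a * grid R m L j ^+ 2)) * sin (z * grid R m L j))).
  by apply: is_derive_eq; rewrite /GRing.scale/=; ring.
exact: is_deriveZ.
Qed.

(** With the integrating factor e^{u^2 / (4a)}, the derivative of e^{u^2 / (4a)} S(u) is that factor
    times the small quantity of [gauss_ode_bound]. The mean value inequality runs from 0 to z, and
    multiplying by e^{-z^2 / (4a)} cancels the factor. *)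
Lemma gauss_sum_fourier (m n : nat) (z : R) : (0 < m)%N -> (0 < n)%N ->
  `|gauss_sum a m (n * m) z - expR (- (z ^+ 2 / (4 * a))) * gauss_sum a m (n * m) 0|
   <= `|z| * (expR (- (a * n%:R ^+ 2)) / a +
      3 * (n%:R / m%:R) * (1 + (`|z| + 2 * a * (n%:R + 1)) ^+ 2 / (2 * a))).
Proof.
move=> m0 n0; set L := (n * m)%N; set eta := (X in _ <= _ * X).
set S := gauss_sum a m L.
have a00 : 0 <= a := ltW a0.
pose E u := m%:R^-1 * \sum_(j < (L + L).+1) dphi u (grid R m L j).
have H1 (u : R) : is_derive u 1 (fun u => expR (u ^+ 2 / (4 * a)) * S u)
    (expR (u ^+ 2 / (4 * a)) * E u).
  have HS : is_derive u 1 S _ := gauss_sum_is_derive m L u.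
  apply: is_derive_eq; rewrite /GRing.scale/= /S /gauss_sum /E /dphi.
  set A := expR (u ^+ 2 / _); set s1 := \sum_j _; set s2 := \sum_j _.
  have -> : \sum_(j < (L + L).+1) expR (- (a * grid R m L j ^+ 2)) *
     (u / (2 * a) * cos (u * grid R m L j) - grid R m L j * sin (u * grid R m L j)) =
     s1 + u / (2 * a) * s2.
    rewrite /s1 /s2 mulr_sumr -big_split/=; apply: eq_bigr => j _; ring.
  by field; rewrite pnatr_eq0 -lt0n m0 gt_eqF.
have H2 (u : R) : Num.min 0 z <= u <= Num.max 0 z ->
    `|expR (u ^+ 2 / (4 * a)) * E u| <= expR (z ^+ 2 / (4 * a)) * eta.
  move=> /between0_norm uz; rewrite normrM ger0_norm ?expR_ge0//.
  apply: ler_pM; rewrite ?expR_ge0//.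
    rewrite ler_expR ler_wpM2r ?invr_ge0 ?mulr_ge0//.
    by rewrite -real_normK ?num_real// -[leRHS]real_normK ?num_real// lerXn2r ?nnegrE.
  apply: (le_trans (gauss_ode_bound u m0 n0)); rewrite /eta lerD2l.
  rewrite ler_wpM2l ?mulr_ge0 ?divr_ge0 ?invr_ge0// lerD2l ler_wpM2r ?invr_ge0 ?mulr_ge0//.
  by rewrite lerXn2r ?nnegrE ?addr_ge0 ?mulr_ge0 ?addr_ge0// lerD2r.
have := derive_lipschitz H1 H2.
rewrite expr0n/= mul0r expR0 mul1r subr0 => H.
set A := z ^+ 2 / (4 * a) in H *.
have K : expR (- A) * expR A = 1 by rewrite -expRD addrC subrr expR0.
have -> : S z - expR (- A) * S 0 = expR (- A) * (expR A * S z - S 0).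
  by rewrite mulrBr [X in _ = X - _]mulrA K mul1r.
rewrite normrM ger0_norm ?expR_ge0//; apply: (le_trans (ler_wpM2l (expR_ge0 _) H)).
by rewrite -(mulrA _ eta) (mulrA (expR (- A))) K mul1r mulrC.
Qed.
End gaussian_sum.

(** * The algorithm as a sum against a kernel *)

Section algorithm_kernel.
Variable R : realType.

Lemma sumz_sym (a b : nat) (F : int -> R[i]) :
  sumz (- a%:Z) b%:Z F = \sum_(j < a + b) F (j%:Z - a%:Z).
Proof.
rewrite /sumz opprK addrC -PoszD max_r ?lez_nat// absz_nat.
by apply: eq_bigr => j _; rewrite addrC.
Qed.

Lemma grid_intr (m N j : nat) : (j%:Z - N%:Z)%:~R / m%:R = grid R m N j.
Proof. by rewrite /grid rmorphB. Qed.

Lemma grid_norm_le (m n j : nat) : (0 < m)%N -> (j <= n * m + n * m)%N ->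
  `|grid R m (n * m) j| <= n%:R.
Proof.
move=> m0 jn; have mR : (0 : R) < m%:R by rewrite ltr0n.
rewrite /grid normrM normfV (gtr0_norm mR) ler_pdivrMr// -natrM.
rewrite ler_norml; apply/andP; split; first by rewrite lerBrDr addrC subrr.
by rewrite lerBlDr -natrD ler_nat.
Qed.

(** The indicator keeps exactly the indices from m^2 - nm up to, but excluding, m^2 + nm; [n <= m]
    makes this range fit, and a shift by m^2 - nm renumbers it. *)
Lemma sum_truncate (m n : nat) (f : R -> R[i]) : (0 < m)%N -> (n <= m)%N ->
  \sum_(j < m ^ 2 + m ^ 2) f (grid R m (m ^ 2) j) *
     (\1_(`[- n%:R, n%:R[%classic) (grid R m (m ^ 2) j : R))%:C
  = \sum_(j < n * m + n * m) f (grid R m (n * m) j).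
Proof.
move=> m0 nm; have mR : (0 : R) < m%:R by rewrite ltr0n.
have nmm : (n * m <= m ^ 2)%N by rewrite -mulnn leq_mul2r nm orbT.
pose G j := f (grid R m (m ^ 2) j) *
     (\1_(`[- n%:R, n%:R[%classic) (grid R m (m ^ 2) j : R))%:C.
have indE j : \1_(`[- n%:R, n%:R[%classic) (grid R m (m ^ 2) j : R) =
    ((m ^ 2 - n * m <= j) && (j < m ^ 2 + n * m))%N%:R :> R.
  rewrite indicE mem_setE in_itv/= /grid ler_pdivlMr// ltr_pdivrMr//.
  rewrite lerBrDr ltrBlDr mulNr -!natrM [- _ + _]addrC -natrB// -natrD !ler_nat ltr_nat.
  by rewrite [(n * m + _)%N]addnC.
rewrite -(big_mkord xpredT G) (@big_cat_nat _ _ _ (m ^ 2 - n * m)%N)//=; last first.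
  by rewrite (leq_trans (leq_subr _ _))// leq_addr.
rewrite big_nat_cond big1 ?add0r; last first.
  move=> j /andP[/andP[_ j1] _]; rewrite /G indE leqNgt j1/=.
  by rewrite rmorph0 mulr0.
rewrite (@big_cat_nat _ _ _ (m ^ 2 + n * m)%N)//=; last 2 first.
- by rewrite (leq_trans (leq_subr _ _))// leq_addr.
- by rewrite leq_add2l.
rewrite [X in _ + X]big_nat_cond [X in _ + X]big1 ?addr0; last first.
  move=> j /andP[/andP[j1 _] _]; rewrite /G indE [(j < _)%N]ltnNge j1 andbF/=.
  by rewrite rmorph0 mulr0.
rewrite -{1}[(m ^ 2 - n * m)%N]add0n big_addn.
have E : (m ^ 2 + n * m - (m ^ 2 - n * m) = n * m + n * m)%N.
  by rewrite subnBA// -addnA addKn.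
rewrite E big_mkord; apply: eq_bigr => j _; rewrite /G indE leq_addl/=.
have -> : (j + (m ^ 2 - n * m) < m ^ 2 + n * m)%N.
  by rewrite addnC -ltn_subRL E.
rewrite rmorph1 mulr1; congr f; congr (_ / _).
by rewrite natrD natrB//; ring.
Qed.

(** The time step has the form given by [psi_step], the factor 1/2 of the algorithm is joined to
    1/m, and the exponent is a natural number, which agrees with the integer power for t >= 0. *)
Definition kernel (m n' : nat) (t x y : R) : R[i] :=
  (2 * m%:R)^-1 * \sum_(j < (n' * m + n' * m).+1)
    (1 - (2 * m%:R * (1 - cos (pi * grid R m (n' * m) j / m%:R)))%:C
        * expi (pi * grid R m (n' * m) j / m%:R)) ^+ absz (Num.floor (m%:R * t))
    * expi (pi * grid R m (n' * m) j * ((Num.floor (m%:R * x))%:~R / m%:R - y)).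

Lemma heat_approx_kernel (g : R -> R[i]) (m n n' : nat) (t x : R) :
  (0 < m)%N -> (n <= m)%N -> 0 <= t ->
  heat_approx g m n n' t x =
  m%:R^-1 * \sum_(k < n * m + n * m)
     g (grid R m (n * m) k) * kernel m n' t x (grid R m (n * m) k).
Proof.
move=> m0 nm t0; have mR : (0 : R) < m%:R by rewrite ltr0n.
have f0 : (0 <= Num.floor (m%:R * t))%R by rewrite floor_ge0 mulr_ge0.
rewrite /heat_approx; congr (_ * _).
have -> : (n' * m)%N%:Z + 1 = (n' * m).+1%:Z by rewrite -PoszD addn1.
rewrite sumz_sym addnS.
have ghatE (j : nat) : ghat g m n (j%:Z - (n' * m)%N%:Z) =
    m%:R^-1 * \sum_(k < n * m + n * m) g (grid R m (n * m) k) *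
       expi (- (pi * grid R m (n * m) k * grid R m (n' * m) j)).
  rewrite /ghat; congr (_ * _); rewrite sumz_sym.
  rewrite -(sum_truncate (fun y => g y * expi (- (pi * y * grid R m (n' * m) j))) m0 nm).
  by apply: eq_bigr => k _; rewrite !grid_intr mulrAC.
under eq_bigr => j _.
  rewrite ghatE grid_intr (psi_step m0 (u := pi * grid R m (n' * m) j / m%:R)); last first.
    by rewrite -grid_intr; field; rewrite gt_eqF.
  rewrite -[Num.floor (m%:R * t)]gez0_abs// -exprnP.
  rewrite mulrA mulr_sumr !mulr_suml.
  over.
rewrite exchange_big/=; apply: eq_bigr => k _.
rewrite [RHS]mulrA mulr_sumr; apply: eq_bigr => j _.
rewrite mulrBr [X in _ = _ * (_ * X)](_ : _ =
   expi (pi * grid R m (n' * m) j * ((Num.floor (m%:R * x))%:~R / m%:R)) *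
   expi (- (pi * grid R m (n * m) k * grid R m (n' * m) j))); last first.
  by rewrite -expiD; congr expi; ring.
by rewrite invfM; ring.
Qed.

(** The imaginary part is odd in the grid point, and reversing the indices maps the grid to its
    negative. *)
Lemma gauss_sum_expi (a z : R) (m L : nat) :
  m%:R^-1 * \sum_(j < (L + L).+1)
    (expR (- (a * grid R m L j ^+ 2)))%:C * expi (z * grid R m L j)
  = (gauss_sum a m L z)%:C.
Proof.
have gr (j : 'I_(L + L).+1) : grid R m L (rev_ord j) = - grid R m L j.
  rewrite /grid/= subSS natrB; last by rewrite -ltnS.
  by rewrite natrD -mulNr; congr (_ / _); ring.
pose s := \sum_(j < (L + L).+1) expR (- (a * grid R m L j ^+ 2)) * sin (z * grid R m L j).
have s0 : s = 0.
  have : s = - s.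
    rewrite {1}/s (reindex_inj rev_ord_inj)/= -sumrN; apply: eq_bigr => j _.
    by rewrite gr sqrrN mulrN sinN mulrN.
  by move=> H; lra.
rewrite /gauss_sum rmorphM fmorphV rmorph_nat; congr (_ * _).
have E (j : 'I_(L + L).+1) :
    (expR (- (a * grid R m L j ^+ 2)))%:C * expi (z * grid R m L j) =
    (expR (- (a * grid R m L j ^+ 2)) * cos (z * grid R m L j))%:C +
    'i%C * (expR (- (a * grid R m L j ^+ 2)) * sin (z * grid R m L j))%:C.
  by apply/eqP; rewrite eq_complex /=; apply/andP; split; apply/eqP; ring.
rewrite (eq_bigr _ (fun j _ => E j)) big_split/= -mulr_sumr -!rmorph_sum/=.
by rewrite -/s s0 mulr0 addr0.
Qed.

(** First [term_bound], summed over the frequencies, leads to half a Gaussian sum with a = t pi^2 at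
    z = pi (x - y). Then [gauss_sum_fourier] applies, where z^2 / (4a) = (x - y)^2 / (4t). *)
Lemma kernel_bound (t x : R) : 0 < t -> exists2 c : R, 0 <= c &
  forall (m n' : nat) (y : R), (0 < m)%N -> (0 < n')%N -> `|y| <= n'%:R ->
    n'%:R ^+ 4 <= 2 * m%:R :> R ->
    normc (kernel m n' t x y -
      (expR (- (x - y) ^+ 2 / (4 * t)) *
         (gauss_sum (t * pi ^+ 2) m (n' * m) 0 / 2))%:C)
    <= c * (n'%:R ^+ 5 / m%:R + n'%:R * expR (- (t * pi ^+ 2 * n'%:R ^+ 2))).
Proof.
move=> t0; set a := t * pi ^+ 2.
have pi0 : (0 : R) < pi := pi_gt0 R.
have a0 : 0 < a by rewrite mulr_gt0// exprn_gt0.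
have pin0 : pi != 0 :> R by rewrite gt_eqF.
have tn0 : t != 0 by rewrite gt_eqF.
have an0 : a != 0 by rewrite gt_eqF.
pose c1 : R := 3 * t * pi ^+ 4 * expR (6 * t * pi ^+ 4) + pi ^+ 2 + pi.
have c10 : 0 <= c1.
  rewrite addr_ge0 ?(ltW pi0)// addr_ge0 ?sqr_ge0// mulr_ge0 ?expR_ge0//.
  by rewrite mulr_ge0 ?exprn_ge0 ?(ltW pi0)// mulr_ge0// ltW.
pose Z : R := pi * (`|x| + 1).
have Z0 : 0 <= Z by rewrite mulr_ge0 ?(ltW pi0)// addr_ge0.
(* Since n' >= 1, both |z| <= Z n' and |z| + 2a (n' + 1) <= (Z + 4a) n' hold, so the Riemann sum
   error is at most c2 n'^3 / m. *)
pose c2 : R := 3 * (1 + (Z + 4 * a) ^+ 2 / (2 * a)).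
have aV : 0 <= a^-1 by rewrite invr_ge0 ltW.
have c20 : 0 <= c2.
  by rewrite mulr_ge0// addr_ge0// mulr_ge0 ?sqr_ge0// invr_ge0 mulr_ge0// ltW.
exists (2 * c1 + Z * (a^-1 + c2)).
  by apply: addr_ge0; apply: mulr_ge0 => //; exact: addr_ge0.
move=> m n' y m0 n0 yn nm.
have mR : (0 : R) < m%:R by rewrite ltr0n.
have m1 : (1 : R) <= m%:R by rewrite ler1n.
have mn0 : m%:R != 0 :> R by rewrite gt_eqF.
have n1 : (1 : R) <= n'%:R by rewrite ler1n.
have nR0 : (0 : R) <= n'%:R by [].
have mV0 : (0 : R) <= m%:R^-1 by rewrite invr_ge0 ltW.
set L := (n' * m)%N; set S0 := gauss_sum _ _ _ _; set z := pi * (x - y).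
have zn : `|z| <= Z * n'%:R.
  rewrite /z /Z normrM (gtr0_norm pi0) -mulrA ler_wpM2l ?(ltW pi0)//.
  apply: (le_trans (ler_normB _ _)); rewrite mulrDl mul1r lerD//.
  by rewrite ler_peMr.
have f0 : (0 <= Num.floor (m%:R * t))%R by rewrite floor_ge0 mulr_ge0 ?(ltW t0).
pose N := absz (Num.floor (m%:R * t)).
have NE : N%:R = (Num.floor (m%:R * t))%:~R :> R.
  by rewrite -[in RHS](gez0_abs f0).
have /andP[N1 N2] := floor_itv (m%:R * t).
have /andP[X1 X2] := floor_itv (m%:R * x).
set X := (Num.floor (m%:R * x))%:~R / m%:R : R.
have Xx : `|X - y - (x - y)| <= m%:R^-1.
  have -> : X - y - (x - y) = ((Num.floor (m%:R * x))%:~R - m%:R * x) / m%:R.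
    by rewrite /X; field; rewrite ?pin0 ?tn0 ?an0 ?mn0.
  rewrite normrM normfV (gtr0_norm mR) ler_piMl// ler_norml.
  by move: X2; rewrite intrD => X2; apply/andP; split; lra.
(* There are 2n'm + 1 <= 4n'm frequencies, each with error c1 n'^4 / m and weight 1 / (2m). *)
have H1 : normc (kernel m n' t x y - (gauss_sum a m L z / 2)%:C)
    <= 2 * c1 * (n'%:R ^+ 5 / m%:R).
  rewrite [(gauss_sum _ _ _ _ / 2)%:C]rmorphM/= fmorphV rmorph_nat -gauss_sum_expi.
  have -> : forall A B : R[i], (2 * m%:R)^-1 * A - m%:R^-1 * B / 2 = (2 * m%:R)^-1 * (A - B).
    by move=> A B; rewrite invfM; ring.
  rewrite -sumrB normcM normcV normcM !normc_nat.
  apply: (@le_trans _ _ ((2 * m%:R)^-1 * ((L + L).+1%:R * (c1 * (n'%:R ^+ 4 / m%:R))))).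
    rewrite ler_wpM2l ?invr_ge0 ?mulr_ge0//; apply: (le_trans (normc_sum _)).
    rewrite [leRHS](_ : _ = \sum_(j < (L + L).+1) c1 * (n'%:R ^+ 4 / m%:R)); last first.
      by rewrite sumr_const card_ord mulr_natl.
    apply: ler_sum => j _.
    rewrite (_ : expi (z * _) = expi (pi * grid R m L j * (x - y))); last first.
      by congr expi; rewrite /z; ring.
    apply: term_bound => //.
    - by apply: grid_norm_le => //; have := ltn_ord j; rewrite ltnS.
    - by rewrite -/N NE [t * _]mulrC.
    - by rewrite -/N NE [t * _]mulrC; move: N2; rewrite intrD => /ltW.
  have -> : 2 * c1 * (n'%:R ^+ 5 / m%:R) =
      (2 * m%:R)^-1 * ((4 * L%:R) * (c1 * (n'%:R ^+ 4 / m%:R))).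
    by rewrite /L natrM; field; rewrite ?pin0 ?tn0 ?an0 ?mn0.
  rewrite ler_wpM2l ?invr_ge0 ?mulr_ge0// ler_wpM2r ?mulr_ge0 ?exprn_ge0//.
  rewrite -natr1 natrD; have : (1 : R) <= L%:R by rewrite ler1n /L muln_gt0 n0.
  by lra.
have H2 : `|gauss_sum a m L z / 2 - expR (- (x - y) ^+ 2 / (4 * t)) * (S0 / 2)|
    <= Z * (a^-1 + c2) * (n'%:R ^+ 5 / m%:R + n'%:R * expR (- (a * n'%:R ^+ 2))).
  have -> : - (x - y) ^+ 2 / (4 * t) = - (z ^+ 2 / (4 * a)).
    have rescale (P u v : R) : P != 0 -> v != 0 ->
        - u ^+ 2 / (4 * v) = - ((P * u) ^+ 2 / (4 * (v * P ^+ 2))).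
      by move=> P0 v0; field; rewrite P0 v0.
    exact: rescale.
  rewrite mulrA -mulrBl normrM [`|2^-1|]ger0_norm//.
  have G := gauss_sum_fourier a0 z m0 n0; rewrite -/L -/S0 in G.
  have P5 : 0 <= n'%:R ^+ 5 / m%:R :> R by rewrite mulr_ge0 ?exprn_ge0.
  have e0 := expR_ge0 (- (a * n'%:R ^+ 2)); set e := expR (- (a * n'%:R ^+ 2)) in G e0 *.
  have B2 : 3 * (n'%:R / m%:R) * (1 + (`|z| + 2 * a * (n'%:R + 1)) ^+ 2 / (2 * a))
      <= c2 * (n'%:R ^+ 3 / m%:R).
    have -> : c2 * (n'%:R ^+ 3 / m%:R) = 3 * (n'%:R / m%:R) *
       (n'%:R ^+ 2 + ((Z + 4 * a) * n'%:R) ^+ 2 / (2 * a)).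
      by rewrite /c2; field; rewrite an0 mn0.
    rewrite ler_wpM2l ?mulr_ge0//; apply: lerD; first by rewrite exprn_ege1.
    have a00 := ltW a0.
    apply: ler_wpM2r; first by rewrite invr_ge0 mulr_ge0.
    have h1 : 0 <= `|z| + 2 * a * (n'%:R + 1).
      by rewrite addr_ge0// mulr_ge0 ?addr_ge0// mulr_ge0.
    have h2 : 0 <= (Z + 4 * a) * n'%:R by rewrite mulr_ge0// addr_ge0// mulr_ge0.
    rewrite lerXn2r ?nnegrE//.
    rewrite [leRHS]mulrDl; apply: lerD => //.
    have : 0 <= a * (2 * n'%:R - 2) by rewrite mulr_ge0//; lra.
    by lra.
  have h3 := le_trans G (ler_wpM2l (normr_ge0 z) (lerD (lexx _) B2)).
  have X0 : 0 <= e / a + c2 * (n'%:R ^+ 3 / m%:R).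
    apply: addr_ge0; first exact: mulr_ge0.
    by apply: mulr_ge0 => //; apply: mulr_ge0 => //; exact: exprn_ge0.
  have h4 : forall A : R, `|A| / 2 <= `|A|.
    by move=> A; rewrite ler_piMr// invf_le1//; lra.
  apply: (le_trans (h4 _)); apply: (le_trans (le_trans h3 (ler_wpM2r X0 zn))).
  have n43 : n'%:R ^+ 4 / m%:R <= n'%:R ^+ 5 / m%:R :> R.
    by rewrite ler_wpM2r// ler_weXn2l.
  have ne0 : 0 <= n'%:R * e by rewrite mulr_ge0.
  have -> : Z * n'%:R * (e / a + c2 * (n'%:R ^+ 3 / m%:R)) =
     Z * (a^-1 * (n'%:R * e) + c2 * (n'%:R ^+ 4 / m%:R)) by ring.
  rewrite -mulrA ler_wpM2l// mulrDl; apply: lerD; rewrite ler_wpM2l//; lra.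
have e0 := expR_ge0 (- (a * n'%:R ^+ 2)).
have ne0 : 0 <= n'%:R * expR (- (a * n'%:R ^+ 2)) by rewrite mulr_ge0.
apply: (le_trans (normc_distD (gauss_sum a m L z / 2)%:C _ _)).
rewrite [leRHS]mulrDl; apply: lerD.
  apply: (le_trans H1); rewrite ler_wpM2l ?mulr_ge0//; lra.
by rewrite -rmorphB normc_real; exact: H2.
Qed.
End algorithm_kernel.

(** * Continuity and growth of complex-valued functions *)

Section complex_valued_functions.
Variable R : realType.

Lemma normr_Re_le (z : R[i]) : `|complex.Re z| <= normc z.
Proof. by have := normc_ge_Re z; rewrite normcE lecR. Qed.

Lemma normr_Im_le (z : R[i]) : `|complex.Im z| <= normc z.
Proof. by case: z => u v /=; rewrite -sqrtr_sqr ler_wsqrtr// lerDr sqr_ge0. Qed.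

Lemma continuous_normc (g : R -> R[i]) : continuous (g : R -> R[i]^o) ->
  forall (y : R) (e : R), 0 < e -> \forall z \near y, normc (g y - g z) < e.
Proof.
move=> gc y e e0; have := gc y => /cvgrPdist_lt /(_ e%:C); rewrite ltcR => /(_ e0).
by apply: filterS => z; rewrite normcE ltcR.
Qed.

Lemma continuous_Re (g : R -> R[i]) : continuous (g : R -> R[i]^o) ->
  continuous (fun y => complex.Re (g y)).
Proof.
move=> gc y; apply/cvgrPdist_lt => e e0.
apply: filterS (continuous_normc gc y e0) => z; apply: le_lt_trans.
by rewrite -raddfB; exact: normr_Re_le.
Qed.

Lemma continuous_Im (g : R -> R[i]) : continuous (g : R -> R[i]^o) ->
  continuous (fun y => complex.Im (g y)).
Proof.
move=> gc y; apply/cvgrPdist_lt => e e0.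
apply: filterS (continuous_normc gc y e0) => z; apply: le_lt_trans.
by rewrite -raddfB; exact: normr_Im_le.
Qed.

Lemma Re_realM (r : R) (z : R[i]) : complex.Re (r%:C * z) = r * complex.Re z.
Proof. by case: z => u v /=; rewrite mul0r subr0. Qed.

Lemma Im_realM (r : R) (z : R[i]) : complex.Im (r%:C * z) = r * complex.Im z.
Proof. by case: z => u v /=; rewrite mul0r addr0. Qed.

Lemma Re_sum (n : nat) (F : 'I_n -> R[i]) :
  complex.Re (\sum_i F i) = \sum_i complex.Re (F i).
Proof. exact: raddf_sum. Qed.

Lemma Im_sum (n : nat) (F : 'I_n -> R[i]) :
  complex.Im (\sum_i F i) = \sum_i complex.Im (F i).
Proof. exact: raddf_sum. Qed.

(** Far out, B |y|^rho <= delta y^2 because |y|^{2 - rho} exceeds |B| / delta; on the remaining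
    compact interval continuity gives a bound. *)
Lemma subquadratic_growth (g : R -> R[i]) (A B rho : R) :
  continuous (g : R -> R[i]^o) -> rho < 2 ->
  (forall x : R, `|g x| <= (A * expR (B * `|x| `^ rho))%:C) ->
  forall delta : R, 0 < delta -> exists2 C : R, 0 <= C &
    forall y, normc (g y) <= C * expR (delta * y ^+ 2).
Proof.
move=> gc rho2 gA delta d0.
have {}gA y : normc (g y) <= A * expR (B * `|y| `^ rho).
  by have := gA y; rewrite normcE lecR.
have A0 : 0 <= A.
  by have := le_trans (normc_ge0 _) (gA 0); rewrite pmulr_lge0 ?expR_gt0.
pose s := 2 - rho; have s0 : 0 < s by rewrite /s; lra.
pose M := Num.max 1 ((`|B| / delta) `^ s^-1).
have M1 : 1 <= M by rewrite le_max lexx.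
(* A real-valued continuous majorant of the modulus, to which the extreme value theorem applies. *)
pose h y := `|complex.Re (g y)| + `|complex.Im (g y)|.
have hc : continuous h.
  move=> y; apply: cvgD; apply: cvg_norm; [exact: continuous_Re|exact: continuous_Im].
have [c _ hM] : exists2 c, c \in `[-M, M] & forall y, y \in `[-M, M] -> h y <= h c.
  by apply: EVT_max; [lra|exact: continuous_subspaceT].
have hc0 : 0 <= h c by rewrite addr_ge0.
exists (h c + A); first by rewrite addr_ge0.
move=> y; have e1 : 1 <= expR (delta * y ^+ 2).
  by rewrite -expR0 ler_expR mulr_ge0 ?sqr_ge0// ltW.
have [yM|My] := leP `|y| M.
  apply: (@le_trans _ _ (h y)); first exact: normc_le_ReIm.
  apply: (@le_trans _ _ (h c)); first by apply: hM; rewrite in_itv/= -ler_norml.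
  by rewrite -[leLHS]mulr1; apply: ler_pM => //; rewrite lerDl.
apply: (le_trans (gA y)); apply: ler_pM; rewrite ?expR_ge0//; first by rewrite lerDr.
have y0 : 0 < `|y| by lra.
have pw : `|y| `^ rho * `|y| `^ s = y ^+ 2.
  rewrite -powRD; last by rewrite (gt_eqF y0) implybT.
  by rewrite /s addrC subrK powR_mulrn// real_normK ?num_real.
have Bs : `|B| / delta <= `|y| `^ s.
  have -> : `|B| / delta = ((`|B| / delta) `^ s^-1) `^ s.
    by rewrite -powRrM mulVf ?gt_eqF// powRr1// divr_ge0// ltW.
  apply: ge0_ler_powR; rewrite ?nnegrE ?powR_ge0 ?(ltW s0)//.
  by apply: le_trans (ltW My); rewrite le_max lexx orbT.
rewrite ler_expR -pw mulrCA.
apply: (@le_trans _ _ (`|B| * `|y| `^ rho)).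
  by rewrite ler_wpM2r ?powR_ge0// ler_norm.
rewrite mulrC ler_wpM2l ?powR_ge0// mulrC -ler_pdivrMr//.
Qed.
End complex_valued_functions.

(** * Limits of the error terms and of the Riemann sums *)

Section limits.
Variable R : realType.

Lemma exists_nat_gt (r : R) : exists N : nat, forall n, (N <= n)%N -> r < n%:R.
Proof. by have [N _ HN] := nbhs_infty_gtr r; exists N => n /HN. Qed.

(** With n^{k+1} <= (k+1)! e^n and bn > 2 + delta, the product is at most (k+1)! e^{-n}. *)
Lemma gaussian_beats_exp (b delta eps : R) (k : nat) : 0 < b -> 0 < eps ->
  exists N : nat, forall n, (N <= n)%N ->
    n%:R ^+ k.+1 * expR (delta * n%:R) * expR (- (b * n%:R ^+ 2)) < eps.
Proof.
move=> b0 e0; set K : R := (k.+1)`!%:R.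
have K0 : 0 < K by rewrite ltr0n fact_gt0.
have [N1 H1] := exists_nat_gt ((2 + delta) / b).
have [N2 H2] := exists_nat_gt (K / eps).
exists (maxn N1 N2) => n; rewrite geq_max => /andP[/H1 n1 /H2 n2].
have n0 : (0 : R) <= n%:R by [].
have nk : n%:R ^+ k.+1 <= K * expR n%:R.
  rewrite mulrC -ler_pdivrMr//; apply: le_trans (expR_ge1Dxn k n0).
  by rewrite lerDr.
have bn : 2 + delta < b * n%:R by rewrite mulrC -ltr_pdivrMr.
apply: (@le_lt_trans _ _ (K * expR (- n%:R))).
  rewrite -mulrA -expRD; apply: (le_trans (ler_wpM2r (expR_ge0 _) nk)).
  rewrite -mulrA -expRD ler_wpM2l ?(ltW K0)// ler_expR.
  have : 0 <= n%:R * (b * n%:R - (2 + delta)) by rewrite mulr_ge0//; lra.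
  by lra.
rewrite expRN ltr_pdivrMr ?expR_gt0// mulrC -ltr_pdivrMr//.
by apply: (lt_le_trans n2); apply: le_trans (expR_ge1Dx _); rewrite lerDr.
Qed.

(** The symmetric grid has one point more than the Riemann sum; its term is at most 1/m, which takes
    the second half of [eps]. *)
Lemma gauss_sum0_cvg (a : R) : 0 < a -> forall eps : R, 0 < eps ->
  exists N : nat, forall m n : nat, (0 < m)%N -> (N <= m)%N -> (N <= n)%N ->
    `|gauss_sum a m (n * m) 0 - Num.sqrt (pi / a)| < eps.
Proof.
move=> a0 eps e0.
have hc : continuous (fun y : R => expR (- (a * y ^+ 2))).
  move=> y; apply: continuous_comp; last exact: continuous_expR.
  by apply: cvgN; apply: cvgM; [exact: cvg_cst|exact: exprn_continuous].
have hD (y : R) : `|expR (- (a * y ^+ 2))| <= 1 * expR (- (a * y ^+ 2)).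
  by rewrite mul1r ger0_norm ?expR_ge0.
have e2 : 0 < eps / 2 by rewrite divr_gt0.
have [N1 H1] := riemann_sum_cvg hc a0 hD e2.
have [N2 H2] := exists_nat_gt (2 / eps).
exists (maxn N1 N2) => m n m0; rewrite !geq_max => /andP[m1 /H2 m2] /andP[n1 _].
have mR : (0 : R) < m%:R by rewrite ltr0n.
have := H1 m n m0 m1 n1; rewrite (gaussian_integral a0).2 => H.
rewrite /gauss_sum big_ord_recr/= mulrDr !mul0r cos0 mulr1.
under eq_bigr do rewrite mul0r cos0 mulr1.
rewrite addrAC (splitr eps); apply: (le_lt_trans (ler_normD _ _)); apply: ltr_leD => //.
rewrite ger0_norm ?mulr_ge0 ?expR_ge0 ?invr_ge0 ?(ltW mR)//.
apply: (@le_trans _ _ (m%:R^-1 * 1)).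
  rewrite ler_wpM2l ?invr_ge0 ?(ltW mR)// -expR0 ler_expR oppr_le0.
  by rewrite mulr_ge0 ?sqr_ge0// ltW.
by rewrite mulr1 -(invf_div 2 eps) lef_pV2 ?posrE ?divr_gt0// ltW.
Qed.

Lemma criemann_sum_cvg (F : R -> R[i]) (D c : R) :
  continuous (F : R -> R[i]^o) -> 0 < c ->
  (forall y, normc (F y) <= D * expR (- (c * y ^+ 2))) ->
  forall eps : R, 0 < eps -> exists N : nat, forall m n : nat,
    (0 < m)%N -> (N <= m)%N -> (N <= n)%N ->
    normc (m%:R^-1 * \sum_(j < n * m + n * m) F (grid R m (n * m) j)
       - cintegral F) < eps.
Proof.
move=> Fc c0 FD eps e0; have e2 : 0 < eps / 2 by rewrite divr_gt0.
have [N1 H1] := riemann_sum_cvg (continuous_Re Fc) c0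
  (fun y => le_trans (normr_Re_le _) (FD y)) e2.
have [N2 H2] := riemann_sum_cvg (continuous_Im Fc) c0
  (fun y => le_trans (normr_Im_le _) (FD y)) e2.
exists (maxn N1 N2) => m n m0; rewrite !geq_max => /andP[m1 m2] /andP[n1 n2].
apply: (le_lt_trans (normc_le_ReIm _)); rewrite (splitr eps); apply: ltrD.
- rewrite raddfB/= -(rmorph_nat (real_complex R)) -fmorphV Re_realM Re_sum.
  exact: H1.
- rewrite raddfB/= -(rmorph_nat (real_complex R)) -fmorphV Im_realM Im_sum.
  exact: H2.
Qed.

Lemma heat_kernel_continuous (g : R -> R[i]) (t x : R) :
  continuous (g : R -> R[i]^o) ->
  continuous ((fun y => (expR (- (x - y) ^+ 2 / (4 * t)))%:C * g y) : R -> R[i]^o).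
Proof.
move=> gc y; apply: cvgM; last exact: gc.
have Ec : {for y, continuous (fun y : R => expR (- (x - y) ^+ 2 / (4 * t)))}.
  apply: continuous_comp; last exact: continuous_expR.
  apply: cvgMl; apply: cvgN.
  apply: (continuous_comp (f := fun y => x - y) (g := fun u => u ^+ 2)).
    by apply: cvgB; [exact: cvg_cst|exact: cvg_id].
  exact: exprn_continuous.
apply/cvgrPdist_lt => e; rewrite ltcE/= => /andP[/eqP ei e0].
move/cvgrPdist_lt : Ec => /(_ _ e0); apply: filterS => z.
rewrite -rmorphB normcE normc_real ltcE /= ei eqxx.
by [].
Qed.

(** The right exponent exceeds the left one by (2x - y)^2 / (8t). Thus growth of rate 1 / (16t)
    still leaves Gaussian decay of the same rate. *)
Lemma gaussian_shift_bound (t x y : R) : 0 < t ->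
  expR (- (x - y) ^+ 2 / (4 * t)) * expR ((16 * t)^-1 * y ^+ 2)
   <= expR (x ^+ 2 / (4 * t)) * expR (- ((16 * t)^-1 * y ^+ 2)).
Proof.
move=> t0; rewrite -!expRD ler_expR.
have tV : 0 < t^-1 by rewrite invr_gt0.
have -> : (16 * t)^-1 = t^-1 / 16 by rewrite invfM mulrC.
have E4 u : u / (4 * t) = u * (t^-1 / 4) by rewrite invfM; ring.
rewrite !E4.
have : 0 <= t^-1 * ((2 * x - y) ^+ 2) by rewrite mulr_ge0 ?sqr_ge0// ltW.
by lra.
Qed.
End limits.

(** * Convergence of the algorithm to the classical solution *)

Unset Implicit Arguments.

Theorem mainTheorem3 (R : realType) (g : R -> R[i]) (A B rho : R)
    (g_cont : continuous (g : R -> R[i]^o))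
    (rho_lt2 : rho < 2)
    (g_growth : forall x : R, `|g x| <= (A * expR (B * `|x| `^ rho))%:C)
    (t x : R) (t_gt0 : 0 < t) :
  forall eps : R, 0 < eps ->
  exists N : nat, forall m n n' : nat,
    (0 < m)%N -> (0 < n)%N -> (0 < n')%N ->
    (N <= m)%N -> (N <= n)%N -> (N <= n')%N ->
    (n%:R : R) < Num.sqrt n'%:R ->
    (n'%:R : R) < Num.sqrt (ln m%:R) ->
    `|heat_approx g m n n' t x - heat_solution g t x| < eps%:C.
Proof.
move=> eps e0; set a := t * pi ^+ 2.
have pi0 := pi_gt0 R.
have a0 : 0 < a by rewrite mulr_gt0// exprn_gt0.
(* The growth rate for which [gaussian_shift_bound] makes [F] below decay like a Gaussian. *)
pose delta := (16 * t)^-1; have d0 : 0 < delta by rewrite invr_gt0 mulr_gt0.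
have [C C0 gC] := subquadratic_growth g_cont rho_lt2 g_growth d0.
have [c cge0 Kc] := kernel_bound x t_gt0.
pose E y := expR (- (x - y) ^+ 2 / (4 * t)).
pose F y : R[i] := (E y)%:C * g y.
pose D := C * expR (x ^+ 2 / (4 * t)).
have FD y : normc (F y) <= D * expR (- (delta * y ^+ 2)).
  rewrite /F normcM normc_real ger0_norm ?expR_ge0//.
  apply: (le_trans (ler_wpM2l (expR_ge0 _) (gC y))); rewrite mulrCA -mulrA ler_wpM2l//.
  exact: gaussian_shift_bound.
pose kappa : R := (Num.sqrt (4 * pi * t))^-1.
have k0 : 0 <= kappa by rewrite invr_ge0 sqrtr_ge0.
(* The limit of half the Gaussian sum at 0 is the normalising constant of the heat kernel. *)
have kE : Num.sqrt (pi / a) / 2 = kappa.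
  have -> : kappa = Num.sqrt ((4 * pi * t)^-1) by rewrite sqrtrV// !mulr_ge0// ltW.
  have -> : 2^-1 = Num.sqrt (4^-1) :> R.
    by rewrite sqrtrV// (_ : 4 = 2 ^+ 2) ?sqrtr_sqr ?ger0_norm// -natrX.
  rewrite -sqrtrM ?divr_ge0 ?(ltW pi0) ?(ltW a0)//; congr Num.sqrt.
  have aux (P : R) : P != 0 -> t != 0 -> P / (t * P ^+ 2) * 4^-1 = (4 * P * t)^-1.
    by move=> P0 tn0; field; rewrite P0 tn0.
  by apply: aux; rewrite gt_eqF.
set W := cintegral F.
have nW0 := normc_ge0 W.
have cC0 : 0 <= c * C by rewrite mulr_ge0.
(* Tolerances giving three errors below eps / 3. Adding 1 keeps the denominators positive, and
   [e3 <= 1] also bounds the Riemann sum [V] by |W| + 1. *)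
pose e1 := eps / (12 * (c * C + 1)).
have e1_gt0 : 0 < e1 by rewrite divr_gt0// mulr_gt0//; lra.
pose e2 := eps / (3 * (normc W + 1)).
have e2_gt0 : 0 < e2 by rewrite divr_gt0// mulr_gt0//; lra.
pose e3 := Num.min 1 (eps / (3 * (kappa + 1))).
have e3_gt0 : 0 < e3.
  by rewrite lt_min ltr01/= divr_gt0// mulr_gt0//; lra.
(* The powers n'^6 and n'^2 are those of the two kernel errors n'^5 / m and n' e^{-a n'^2} times the
   window length. The rate 1 comes from 1/m <= e^{-n'^2}. *)
have [N1 H1] := gaussian_beats_exp delta 5 (@ltr01 R) e1_gt0.
have [N2 H2] := gaussian_beats_exp delta 1 a0 e1_gt0.
have [N3 H3] := gauss_sum0_cvg a0 e2_gt0.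
have [N4 H4] := criemann_sum_cvg (heat_kernel_continuous (t := t) (x := x) g_cont) d0 FD e3_gt0.
exists (maxn (maxn N1 N2) (maxn N3 N4)) => m n n' m0 n0 n'0.
rewrite !geq_max => /andP[_ /andP[m3 m4]] /andP[_ /andP[n3 n4]].
move=> /andP[/andP[n'1 n'2] /andP[n'3 n'4]] nn' n'm.
rewrite normcE ltcR.
have mR : (0 : R) < m%:R by rewrite ltr0n.
have n1 : (1 : R) <= n%:R by rewrite ler1n.
have n'R1 : (1 : R) <= n'%:R by rewrite ler1n.
have n'R0 : (0 : R) <= n'%:R by [].
have mV0 : (0 : R) <= m%:R^-1 by rewrite invr_ge0 ltW.
have n2n' : n%:R ^+ 2 <= n'%:R :> R.
  by rewrite -[leRHS]sqr_sqrtr// lerXn2r ?nnegrE ?sqrtr_ge0// ltW.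
have nlen' : n%:R <= n'%:R :> R.
  by apply: le_trans n2n'; rewrite expr2 ler_peMr// ler0n.
have em : expR (n'%:R ^+ 2) <= m%:R :> R.
  rewrite -[leRHS]lnK ?posrE// ler_expR.
  have ln0 : 0 <= ln m%:R :> R by rewrite ln_ge0// ler1n.
  by rewrite -[leRHS]sqr_sqrtr// lerXn2r ?nnegrE ?sqrtr_ge0// ltW.
(* From e^v >= 1 + v^2 / 2 at v = n'^2. *)
have nm4 : n'%:R ^+ 4 <= 2 * m%:R :> R.
  have := expR_ge1Dxn 1 (sqr_ge0 (n'%:R : R)).
  by rewrite -exprM (_ : 2`!%:R = 2 :> R)// => H; lra.
have nm : (n <= m)%N.
  rewrite -(ler_nat R); apply: le_trans em; apply: le_trans (expR_ge1Dx _).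
  by apply: (le_trans nlen'); rewrite expr2; nra.
have mV : m%:R^-1 <= expR (- (1 * n'%:R ^+ 2)) :> R.
  by rewrite mul1r expRN lef_pV2 ?posrE ?expR_gt0.
rewrite (heat_approx_kernel _ _ _ m0 nm (ltW t_gt0)).
rewrite /heat_solution gt_eqF// -/kappa -/(cintegral F).
rewrite (_ : cintegral _ = W)//.
set S0 := gauss_sum a m (n' * m) 0.
(* Three replacements follow: the kernel by a Gaussian times S0 / 2, then S0 / 2 by [kappa], then
   the Riemann sum [V] by the integral [W]. *)
pose V := m%:R^-1 * \sum_(j < n * m + n * m) F (grid R m (n * m) j).
have VW := H4 m n m0 m4 n4; rewrite -/V -/W in VW.
have SK := H3 m n' m0 m3 n'3; rewrite -/S0 in SK.
pose err : R := c * (n'%:R ^+ 5 / m%:R + n'%:R * expR (- (a * n'%:R ^+ 2))).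
have T1 : normc (m%:R^-1 * (\sum_(k < n * m + n * m) g (grid R m (n * m) k) *
     kernel m n' t x (grid R m (n * m) k)) - (S0 / 2)%:C * V) < eps / 3.
  have -> : (S0 / 2)%:C * V = m%:R^-1 * (\sum_(k < n * m + n * m)
      g (grid R m (n * m) k) * (E (grid R m (n * m) k) * (S0 / 2))%:C).
    rewrite /V mulrCA mulr_sumr; congr (_ * _); apply: eq_bigr => k _.
    by rewrite /F [(E _ * _)%:C]rmorphM/=; ring.
  rewrite -mulrBr -sumrB normcM normcV normc_nat.
  have tb (k : 'I_(n * m + n * m)) :
    normc (g (grid R m (n * m) k) * kernel m n' t x (grid R m (n * m) k) -
       g (grid R m (n * m) k) * (E (grid R m (n * m) k) * (S0 / 2))%:C)
    <= C * expR (delta * n'%:R) * err.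
    have gk : `|grid R m (n * m) k| <= n%:R by apply: grid_norm_le => //; exact: ltnW.
    rewrite -mulrBr normcM; apply: ler_pM; rewrite ?normc_ge0//.
      apply: (le_trans (gC _)); rewrite ler_wpM2l// ler_expR ler_wpM2l ?(ltW d0)//.
      by apply: le_trans n2n'; rewrite -real_normK ?num_real// lerXn2r ?nnegrE.
    by apply: Kc => //; exact: le_trans nlen'.
  have := le_trans (normc_sum _) (ler_sum _ (fun k _ => tb k)).
  rewrite sumr_const card_ord -[X in _ <= X]mulr_natl => /(ler_wpM2l mV0) /le_lt_trans; apply.
  (* The 2nm terms of weight 1/m contribute the window length 2n, later bounded by 2n'. *)
  rewrite [_ * (_ * _)]mulrA natrD natrM (_ : m%:R^-1 * (n%:R * m%:R + n%:R * m%:R) = 2 * n%:R); last first.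
    by field; rewrite gt_eqF.
  have B1 := H1 n' n'1; have B2 := H2 n' n'2.
  set ed := expR (delta * n'%:R) in B1 B2 *.
  have ed0 : 0 <= ed := expR_ge0 _.
  have ea0 := expR_ge0 (- (a * n'%:R ^+ 2)).
  have err0 : 0 <= err.
    exact: mulr_ge0.
  have err_le : err <= c * (n'%:R ^+ 5 * expR (- (1 * n'%:R ^+ 2)) + n'%:R * expR (- (a * n'%:R ^+ 2))).
    by rewrite /err ler_wpM2l// lerD2r ler_wpM2l// exprn_ge0.
  apply: (@le_lt_trans _ _ (2 * n'%:R * (C * ed *
     (c * (n'%:R ^+ 5 * expR (- (1 * n'%:R ^+ 2)) + n'%:R * expR (- (a * n'%:R ^+ 2))))))).
    apply: ler_pM; [exact: mulr_ge0|apply: mulr_ge0 err0; exact: mulr_ge0| |].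
      by rewrite ler_wpM2l.
    by apply: ler_wpM2l err_le; exact: mulr_ge0.
  have -> : 2 * n'%:R * (C * ed *
     (c * (n'%:R ^+ 5 * expR (- (1 * n'%:R ^+ 2)) + n'%:R * expR (- (a * n'%:R ^+ 2))))) =
     2 * (c * C) * (n'%:R ^+ 6 * ed * expR (- (1 * n'%:R ^+ 2)) +
       n'%:R ^+ 2 * ed * expR (- (a * n'%:R ^+ 2))) by ring.
  apply: (@le_lt_trans _ _ (2 * (c * C) * (e1 + e1))).
    by rewrite ler_wpM2l ?mulr_ge0//; apply: lerD; exact: ltW.
  have -> : eps / 3 = 4 * (c * C + 1) * e1.
    by rewrite /e1; field; rewrite gt_eqF//; lra.
  by nra.
have T2 : normc ((S0 / 2)%:C * V - kappa%:C * V) < eps / 3.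
  rewrite -mulrBl -rmorphB normcM normc_real -kE -mulrBl normrM [`|2^-1|]ger0_norm//.
  have V1 : normc V <= normc W + 1.
    rewrite -[V](subrK W) addrC; apply: (le_trans (normcD _ _)); rewrite lerD2l.
    by apply: (le_trans (ltW VW)); rewrite /e3 ge_min lexx.
  apply: (@le_lt_trans _ _ (`|S0 - Num.sqrt (pi / a)| * (normc W + 1))).
    apply: ler_pM; rewrite ?normc_ge0 ?mulr_ge0//.
    by rewrite ler_piMr// invf_le1//; lra.
  have W1 : 0 < normc W + 1 by lra.
  have -> : eps / 3 = e2 * (normc W + 1) by rewrite /e2; field; rewrite gt_eqF.
  by rewrite ltr_pM2r.
have T3 : normc (kappa%:C * V - kappa%:C * W) < eps / 3.
  rewrite -mulrBr normcM normc_real ger0_norm//.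
  have K1 : 0 < kappa + 1 by lra.
  apply: (@lt_le_trans _ _ ((kappa + 1) * e3)).
    apply: (@le_lt_trans _ _ ((kappa + 1) * normc (V - W))).
      by rewrite ler_wpM2r ?normc_ge0//; lra.
    by rewrite ltr_pM2l.
  apply: (@le_trans _ _ ((kappa + 1) * (eps / (3 * (kappa + 1))))).
    by rewrite ler_wpM2l ?(ltW K1)// /e3 ge_min lexx orbT.
  by rewrite le_eqVlt; apply/orP; left; apply/eqP; field; rewrite gt_eqF.
apply: (le_lt_trans (normc_distD ((S0 / 2)%:C * V) _ _)).
have := normc_distD (kappa%:C * V) ((S0 / 2)%:C * V) (kappa%:C * W).
by lra.
Qed.
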